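(* For every non-empty regular language $L\subseteq\Sigma^*$, the problem $\mathsf{CFG}$-$\mathsf{IP}(L,\Sigma)$ is $\mathsf{P}$-complete.
   Context: $\mathsf{CFG}$-$\mathsf{IP}(L,\Sigma)$ (intersection non-emptiness for $L$) is the problem: given a context-free grammar $\mathcal{G}$ over the terminal alphabet $\Sigma$, decide whether $L(\mathcal{G})\cap L\neq\emptyset$. The language $L$ is fixed (not part of the input). $\mathsf{P}$-completeness is with respect to logspace reductions. *)

(* Defs.v *)
From HB Require Import structures.
From mathcomp Require Import all_boot.

Set Implicit Arguments.
Unset Strict Implicit.
Unset Printing Implicit Defensive.

Definition lang (A : Type) := seq A -> Prop.

(* ** Regular languages *)

Record dfa (A : finType) := Dfa {
  dfa_state : finType;
  dfa_start : dfa_state;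
  dfa_final : pred dfa_state;
  dfa_trans : dfa_state -> A -> dfa_state }.

Definition dfa_accepts (A : finType) (M : dfa A) (w : seq A) : bool :=
  dfa_final (foldl (@dfa_trans A M) (dfa_start M) w).

Definition regular (A : finType) (L : lang A) : Prop :=
  exists M : dfa A, forall w, L w <-> dfa_accepts M w.

(* ** Context-free grammars *)

(* The finite set of nonterminals is left implicit: it consists of the elements
   of N that occur in the grammar. Empty right-hand sides are allowed. *)
Record cfg (N Sigma : eqType) := Cfg {
  cfg_start : N;
  cfg_rules : seq (N * seq (N + Sigma)) }.

Section Derivation.
Variables (N Sigma : eqType) (G : cfg N Sigma).

Definition derives1 (u v : seq (N + Sigma)) : Prop :=
  exists (l r : seq (N + Sigma)) (A : N) (rhs : seq (N + Sigma)),
    [/\ (A, rhs) \in cfg_rules G, u = l ++ inl A :: r & v = l ++ rhs ++ r].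

Inductive derives (u : seq (N + Sigma)) : seq (N + Sigma) -> Prop :=
| derives_refl : derives u u
| derives_step v v' : derives u v -> derives1 v v' -> derives u v'.

Definition cfg_lang : lang Sigma :=
  fun w => derives [:: inl (cfg_start G)] (map inr w).

End Derivation.

(* ** Grammars as words over a finite alphabet *)

Inductive gsym (Sigma : Type) :=
| GBit of bool
| GTerm of Sigma
| GNonterm
| GRule.
Arguments GBit {Sigma} _.
Arguments GNonterm {Sigma}.
Arguments GRule {Sigma}.

Definition gsym_code (Sigma : Type) (x : gsym Sigma) : bool + Sigma + bool :=
  match x with
  | GBit b => inl (inl b)
  | GTerm a => inl (inr a)
  | GNonterm => inr false
  | GRule => inr true
  end.

Definition gsym_decode (Sigma : Type) (x : bool + Sigma + bool) : gsym Sigma :=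
  match x with
  | inl (inl b) => GBit b
  | inl (inr a) => GTerm a
  | inr false => GNonterm
  | inr true => GRule
  end.

Lemma gsym_codeK (Sigma : Type) :
  cancel (@gsym_code Sigma) (@gsym_decode Sigma).
Proof. by case. Qed.

HB.instance Definition _ (Sigma : eqType) :=
  Equality.copy (gsym Sigma) (can_type (@gsym_codeK Sigma)).
HB.instance Definition _ (Sigma : choiceType) :=
  Choice.copy (gsym Sigma) (can_type (@gsym_codeK Sigma)).
HB.instance Definition _ (Sigma : countType) :=
  Countable.copy (gsym Sigma) (can_type (@gsym_codeK Sigma)).
HB.instance Definition _ (Sigma : finType) :=
  Finite.copy (gsym Sigma) (can_type (@gsym_codeK Sigma)).

(* Nonterminals of an input grammar are named by arbitrary binary words. With
   [ marking a name and | marking a rule, the grammar with start symbol S and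
   rules A1 -> X11 X12 ..., A2 -> X21 X22 ..., ... is written
     [S |[A1 X11 X12 ... |[A2 X21 X22 ... ...
   where a nonterminal X is written [X. This encoding is injective. *)
Definition bcfg (Sigma : finType) := cfg (seq bool) Sigma.

Section Encoding.
Variable Sigma : finType.

Definition encode_nonterm (A : seq bool) : seq (gsym Sigma) :=
  GNonterm :: map GBit A.

Definition encode_symbol (x : seq bool + Sigma) : seq (gsym Sigma) :=
  match x with
  | inl A => encode_nonterm A
  | inr a => [:: GTerm a]
  end.

Definition encode_rule (r : seq bool * seq (seq bool + Sigma)) :
    seq (gsym Sigma) :=
  GRule :: encode_nonterm r.1 ++ flatten (map encode_symbol r.2).

Definition encode_cfg (G : bcfg Sigma) : seq (gsym Sigma) :=
  encode_nonterm (cfg_start G) ++ flatten (map encode_rule (cfg_rules G)).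

Definition cfg_ip (L : lang Sigma) : lang (gsym Sigma) :=
  fun x => exists G : bcfg Sigma,
    x = encode_cfg G /\ exists w, cfg_lang G w /\ L w.

End Encoding.

(* ** Turing machines *)

Inductive move := MLeft | MStay | MRight.

(* Deterministic Turing machines with a two-way read-only input tape over A
   with end markers, tm_tapes one-way infinite work tapes, and a one-way
   write-only output tape over B. The scanned input cell holds inl false (left
   marker), inl true (right marker) or inr a (the letter a); None is the blank
   of the work tapes. A transition gives the next state, the move of the input
   head, what to write and how to move on each work tape, and possibly a letter
   to output. The machine halts when tm_trans is None. *)
Record tm (A B : finType) := TM {
  tm_tapes : nat;
  tm_sym : finType;
  tm_state : finType;
  tm_start : tm_state;
  tm_accept : pred tm_state;
  tm_trans : tm_state -> bool + A -> {ffun 'I_tm_tapes -> option tm_sym} ->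
    option (tm_state * move * {ffun 'I_tm_tapes -> option tm_sym * move}
            * option B) }.

Section Run.
Variables (A B : finType) (M : tm A B).

Record config := Config {
  c_state : tm_state M;
  c_input : nat;
  c_head : 'I_(tm_tapes M) -> nat;
  c_tape : 'I_(tm_tapes M) -> nat -> option (tm_sym M);
  c_output : seq B }.

Definition init : config :=
  Config (tm_start M) 0 (fun=> 0) (fun _ _ => None) [::].

(* The left marker is in cell 0, the letters of w are in cells 1, ..., size w,
   and the right marker is in cell (size w).+1. *)
Definition input_at (w : seq A) (p : nat) : bool + A :=
  if p is p'.+1 then (if onth w p' is Some a then inr a else inl true)
  else inl false.

(* On one-way infinite tapes, moving left from cell 0 has no effect. *)
Definition shift (m : move) (p : nat) : nat :=
  match m with MLeft => p.-1 | MStay => p | MRight => p.+1 end.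

Definition next (w : seq A) (c : config) : option config :=
  match tm_trans (c_state c) (input_at w (c_input c))
          [ffun j => c_tape c j (c_head c j)] with
  | None => None
  | Some (q, m, act, o) =>
      Some (Config q
        (minn (shift m (c_input c)) (size w).+1)
        (fun j => shift (act j).2 (c_head c j))
        (fun j p => if p == c_head c j then (act j).1 else c_tape c j p)
        (if o is Some b then rcons (c_output c) b else c_output c))
  end.

(* The configuration reached after exactly n steps, if any. *)
Definition run (w : seq A) (n : nat) : option config :=
  iter n (obind (next w)) (Some init).

Definition halts_with (w : seq A) (n : nat) (c : config) : Prop :=
  run w n = Some c /\ next w c = None.

End Run.

(* ** P and logspace reductions *)

Definition in_P (A : finType) (X : lang A) : Prop :=
  exists (M : tm A void) (k d : nat), forall w,
    exists (n : nat) (c : config M),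
      [/\ n <= k * size w ^ d + k, halts_with w n c
        & X w <-> tm_accept (c_state c)].

Definition logspace_computable (A B : finType) (f : seq A -> seq B) : Prop :=
  exists (M : tm A B) (k : nat), forall w,
    (exists (n : nat) (c : config M), halts_with w n c /\ c_output c = f w) /\
    (forall (n : nat) (c : config M), run M w n = Some c ->
       forall j, c_head c j < k * trunc_log 2 (size w) + k).

Definition logspace_reducible (A B : finType) (X : lang A) (Y : lang B) : Prop :=
  exists f : seq A -> seq B,
    logspace_computable f /\ forall w, X w <-> Y (f w).

Definition P_hard (B : finType) (Y : lang B) : Prop :=
  forall (A : finType) (X : lang A), in_P X -> logspace_reducible X Y.

Definition P_complete (B : finType) (Y : lang B) : Prop :=
  in_P Y /\ P_hard Y.

(* Main.v *)
From HB Require Import structures.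
From mathcomp Require Import all_boot zify.
Require Import Defs.

(* Membership. Fix a DFA for L with state set Q. For a nonterminal A let R(A)
   be the relation on Q formed by the pairs linked by some word that A derives.
   These relations are the least solution of R(A) >= R(X1) o ... o R(Xk), for
   the rules A -> X1 ... Xk, so they are reached after (number of rules) * |Q|^2
   rounds. As Q is fixed, a relation is a single tape symbol; the machine logs
   the pairs (A, relation) and finds R(A) by comparing names with the log.

   Hardness. A polynomial-time computation is described by Horn clauses about
   times and positions below 2^m, where m is O(log n): state at a time, head
   position, content of a cell. A Horn clause is a rule whose right-hand side
   contains only nonterminals, and a fact holds iff its nonterminal derives the
   empty word. A last rule S -> Acc u, with u in L, turns acceptance into the
   generation of u. The clauses only mention times t, t + 1 and positions p,
   p + 1, hence a transducer with two binary counters of m bits writes them. *)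

Set Implicit Arguments.
Unset Strict Implicit.
Unset Printing Implicit Defensive.

(** * Stack programs and their compilation to Turing machines *)

Arguments input_at : simpl never.

(** Both halves need bounds on concrete Turing machines. The two machines are therefore written as
    structured programs over finitely many stacks. One compiler turns each program step into two
    machine steps and keeps every work head at the height of its stack, so time and space are
    analysed for programs only.

    Log entries are never merged: every rule appends one in every round. The log stays polynomial
    because a round adds at most as many cells as the input has letters. Words that encode no
    grammar must be rejected, hence a finite automaton for the format.

    Horn clauses have no negation and see only neighbouring positions. So a cell away from its head
    is certified by the positive facts [TLeft] and [TRight], position 0 by [TZero], and a scanned
    symbol is spread over all positions, which lets symbols under distant heads meet in one clause.
    That nothing false is derivable follows by taking the actual trajectory as a model of the
    clauses. For time [k * n ^ d + k], the number of digits m is [2 * k] plus [d] times the binary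
    length of [n]. *)

Lemma runS (A B : finType) (M : tm A B) w n c :
  run M w n = Some c -> run M w n.+1 = next w c.
Proof. by rewrite /run /= => ->. Qed.

Inductive sop (S : Type) := Keep | Pop | Push of S.
Arguments Keep {S}.
Arguments Pop {S}.

Definition sop_app (S : Type) (o : sop S) (s : seq S) : seq S :=
  match o with Keep => s | Pop => behead s | Push x => x :: s end.

Section Programs.

Variables (A B V S : finType) (k : nat).

Record store := Store {
  sv : V; spos : nat; sstk : seq (seq S); sout : seq B }.

Definition act := (V * move * seq (sop S) * option B)%type.

(** The variable, the scanned input letter and the tops of the stacks are finite information, which
    is what a transition function may depend on. *)
Definition obs (X : Type) := V -> bool + A -> seq (option S) -> X.

(* A transition to no state ends the fragment; a transition without an action
   only changes the control state. *)
Record frag := Frag {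
  fq : finType;
  f0 : fq;
  ft : fq -> obs (option (fq * option act)) }.

Definition doF (f : obs act) : frag :=
  @Frag bool false (fun q v a t =>
    if q then None else Some (true, Some (f v a t))).

Definition seqF (F G : frag) : frag :=
  @Frag (fq F + fq G)%type (inl (f0 F)) (fun q v a t =>
    match q with
    | inl q => if ft q v a t is Some (q', x) then Some (inl q', x)
               else Some (inr (f0 G), None)
    | inr q => if ft q v a t is Some (q', x) then Some (inr q', x) else None
    end).

Definition ifF (b : obs bool) (F G : frag) : frag :=
  @Frag (option (fq F + fq G)) None (fun q v a t =>
    match q with
    | None => Some (Some (if b v a t then inl (f0 F) else inr (f0 G)), None)
    | Some (inl q) =>
        if ft q v a t is Some (q', x) then Some (Some (inl q'), x) else None
    | Some (inr q) =>
        if ft q v a t is Some (q', x) then Some (Some (inr q'), x) else None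
    end).

Definition whileF (b : obs bool) (F : frag) : frag :=
  @Frag (option (fq F)) None (fun q v a t =>
    match q with
    | None => if b v a t then Some (Some (f0 F), None) else None
    | Some q => if ft q v a t is Some (q', x) then Some (Some q', x)
                else Some (None, None)
    end).

Definition skipF : frag := @Frag unit tt (fun _ _ _ _ => None).

Definition seqsF (Fs : seq frag) : frag := foldr seqF skipF Fs.

Section Semantics.

Variables (w : seq A) (ok : seq (seq S) -> Prop).

Definition look (X : Type) (f : obs X) (s : store) : X :=
  f (sv s) (input_at w (spos s)) (map ohead (sstk s)).

Definition doact (a : act) (s : store) : store :=
  let: (v, m, ops, o) := a in
  Store v (minn (shift m (spos s)) (size w).+1)
    (mkseq (fun j => sop_app (nth Keep ops j) (nth [::] (sstk s) j)) k)
    (if o is Some b then rcons (sout s) b else sout s).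


Definition fstep (F : frag) (q : fq F) (s : store) : option (fq F * store) :=
  if look (@ft F q) s is Some (q', a) then
    Some (q', if a is Some a then doact a s else s)
  else None.

(** [ok] is required at every visited store, not only at the last one: a bound on stack heights
    thereby bounds the work tapes during the whole run. *)
Inductive runs (F : frag) : fq F -> store -> nat -> fq F -> store -> Prop :=
| runs_refl q s : ok (sstk s) -> runs q s 0 q s
| runs_step q s q1 s1 n q2 s2 :
    ok (sstk s) -> fstep q s = Some (q1, s1) -> runs q1 s1 n q2 s2 ->
    runs q s n.+1 q2 s2.

Definition exec (F : frag) (s : store) (n : nat) (s' : store) : Prop :=
  exists q, runs (f0 F) s n q s' /\ fstep q s' = None.

Lemma runs_cat F q s n q1 s1 m q2 s2 :
  @runs F q s n q1 s1 -> runs q1 s1 m q2 s2 -> runs q s (n + m) q2 s2.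
Proof.
elim=> [//|{}q {}s p r n' {}q1 {}s1 oks sp _ IH] yz.
by rewrite addSn; apply: runs_step oks sp (IH yz).
Qed.

Lemma runs_okl F q s n q1 s1 : @runs F q s n q1 s1 -> ok (sstk s).
Proof. by case. Qed.

Lemma runs_okr F q s n q1 s1 : @runs F q s n q1 s1 -> ok (sstk s1).
Proof. by elim. Qed.

(** Each combinator embeds the states of its parts by a constructor that commutes with steps, and
    inherits their runs through this lemma. *)
Lemma runs_map F G (h : fq F -> fq G) q s n q1 s1 :
  (forall q s q' s', @fstep F q s = Some (q', s') ->
     fstep (h q) s = Some (h q', s')) ->
  runs q s n q1 s1 -> runs (h q) s n (h q1) s1.
Proof.
move=> hP; elim=> [{}q {}s oks|{}q {}s p r n' {}q1 {}s1 oks sp _ IH].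
  exact: runs_refl.
exact: runs_step oks (hP _ _ _ _ sp) IH.
Qed.

Lemma exec_do f s s' :
  ok (sstk s) -> ok (sstk s') -> s' = doact (look f s) s ->
  exec (doF f) s 1 s'.
Proof.
move=> oks oks' es'; subst s'; exists true; split=> //.
apply: (@runs_step (doF f) _ _ true (doact (look f s) s)) => //.
exact: runs_refl.
Qed.

Lemma exec_skip s : ok (sstk s) -> exec skipF s 0 s.
Proof. by move=> oks; exists tt; split=> //; apply: runs_refl. Qed.

(** The additional step is the silent transition from the end of [F] to the start of [G]. *)
Lemma exec_seq F G s n s1 m s2 :
  exec F s n s1 -> exec G s1 m s2 -> exec (seqF F G) s (n + m).+1 s2.
Proof.
move=> [q [r1 e1]] [q' [r2 e2]]; exists (inr q'); split; last first.
  by move: e2; rewrite /fstep /look /=; case: (ft _ _ _ _) => [[]|].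
have r1' : @runs (seqF F G) (inl (f0 F)) s n (inl q) s1.
  apply: (@runs_map F (seqF F G) inl) r1 => p r p' r'; rewrite /fstep /look /=.
  by case: (ft _ _ _ _) => [[x y]|] // [-> ->].
have r2' : @runs (seqF F G) (inr (f0 G)) s1 m (inr q') s2.
  apply: (@runs_map G (seqF F G) inr) r2 => p r p' r'; rewrite /fstep /look /=.
  by case: (ft _ _ _ _) => [[x y]|] // [-> ->].
rewrite -addnS; apply: runs_cat r1' (runs_step _ _ r2').
  exact: runs_okr r1.
by move: e1; rewrite /fstep /look /=; case: (ft _ _ _ _) => [[]|].
Qed.

Lemma exec_if (b : obs bool) F G s n s' :
  exec (if look b s then F else G) s n s' -> exec (ifF b F G) s n.+1 s'.
Proof.
case: (boolP (look b s)) => bs [q [r e]].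
- exists (Some (inl q)); split; last first.
    by move: e; rewrite /fstep /look /=; case: (ft _ _ _ _) => [[]|].
  apply: (@runs_step (ifF b F G) _ _ (Some (inl (f0 F))) s); first exact: runs_okl r.
    by move: bs; rewrite /fstep /look /= => ->.
  apply: (@runs_map F (ifF b F G) (fun q : fq F => Some (inl q))) r => p r p' r'.
  rewrite /fstep /look /=.
  by case: (ft _ _ _ _) => [[x y]|] // [-> ->].
- exists (Some (inr q)); split; last first.
    by move: e; rewrite /fstep /look /=; case: (ft _ _ _ _) => [[]|].
  apply: (@runs_step (ifF b F G) _ _ (Some (inr (f0 G))) s); first exact: runs_okl r.
    by move: bs; rewrite /fstep /look /= => /negbTE ->.
  apply: (@runs_map G (ifF b F G) (fun q : fq G => Some (inr q))) r => p r p' r'.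
  rewrite /fstep /look /=.
  by case: (ft _ _ _ _) => [[x y]|] // [-> ->].
Qed.

Lemma exec_whileN (b : obs bool) F s :
  ok (sstk s) -> look b s = false -> exec (whileF b F) s 0 s.
Proof.
move=> oks bs; exists None; split; first exact: runs_refl.
by move: bs; rewrite /fstep /look /= => ->.
Qed.

(** Of the two additional steps, one enters the body after the test and one returns to the test. *)
Lemma exec_whileT (b : obs bool) F s n s1 m s2 :
  look b s -> exec F s n s1 -> exec (whileF b F) s1 m s2 ->
  exec (whileF b F) s (n + m).+2 s2.
Proof.
move=> bs [q [r1 e1]] [q' [r2 e2]]; exists q'; split=> //.
have r1' : @runs (whileF b F) (Some (f0 F)) s n (Some q) s1.
  apply: (@runs_map F (whileF b F) Some) r1 => p r p' r'; rewrite /fstep /look /=.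
  by case: (ft _ _ _ _) => [[x y]|] // [-> ->].
apply: (@runs_step (whileF b F) _ _ (Some (f0 F)) s); first exact: runs_okl r1.
  by move: bs; rewrite /fstep /look /= => ->.
rewrite -addnS; apply: runs_cat r1' (runs_step _ _ r2).
  exact: runs_okr r1.
by move: e1; rewrite /fstep /look /=; case: (ft _ _ _ _) => [[]|].
Qed.

Definition exec_le (F : frag) (s : store) (t : nat) (s' : store) : Prop :=
  exists2 n, n <= t & exec F s n s'.

Lemma exec_le_trans F s t s' t' :
  exec_le F s t s' -> t <= t' -> exec_le F s t' s'.
Proof. by move=> [n nt e] tt'; exists n => //; apply: leq_trans tt'. Qed.

Lemma exec_le_do f s s' t :
  ok (sstk s) -> ok (sstk s') -> s' = doact (look f s) s -> 0 < t ->
  exec_le (doF f) s t s'.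
Proof. by move=> oks oks' es' t0; exists 1 => //; apply: exec_do. Qed.

Lemma exec_le_seqs F Fs s n s1 m s2 t :
  exec_le F s n s1 -> exec_le (seqsF Fs) s1 m s2 -> n + m < t ->
  exec_le (seqsF (F :: Fs)) s t s2.
Proof.
move=> [n' hn e] [m' hm e'] ht; exists (n' + m').+1; last exact: exec_seq e e'.
by lia.
Qed.

Lemma exec_le_nil s : ok (sstk s) -> exec_le (seqsF [::]) s 0 s.
Proof. by move=> oks; exists 0 => //; apply: exec_skip. Qed.

Lemma exec_le_ifT (b : obs bool) F G s n s' t :
  look b s -> exec_le F s n s' -> n < t -> exec_le (ifF b F G) s t s'.
Proof.
move=> bs [m mn e] nt; exists m.+1; first exact: leq_ltn_trans nt.
by apply: exec_if; rewrite bs.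
Qed.

Lemma exec_le_ifF (b : obs bool) F G s n s' t :
  look b s = false -> exec_le G s n s' -> n < t -> exec_le (ifF b F G) s t s'.
Proof.
move=> bs [m mn e] nt; exists m.+1; first exact: leq_ltn_trans nt.
by apply: exec_if; rewrite bs.
Qed.

Lemma exec_le_whileN (b : obs bool) F s t :
  ok (sstk s) -> look b s = false -> exec_le (whileF b F) s t s.
Proof. by move=> oks bs; exists 0 => //; apply: exec_whileN. Qed.

Lemma exec_le_whileT (b : obs bool) F s n s1 m s2 t :
  look b s -> exec_le F s n s1 -> exec_le (whileF b F) s1 m s2 ->
  n + m + 1 < t -> exec_le (whileF b F) s t s2.
Proof.
move=> bs [n' hn e] [m' hm e'] ht.
exists (n' + m').+2; last exact: exec_whileT e'.
by lia.
Qed.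

End Semantics.

(** * Translation of stack programs into Turing machines *)

Section Compile.

Variables (F : frag) (v0 : V) (acc : pred V).

(* The head of a work tape scans the top of its stack, the cell 0 staying
   blank. A push needs one step to move right and one step to write: the states
   of the second summand hold the symbols that remain to be written. *)
Definition cstate := (fq F * V + fq F * V * {ffun 'I_k -> option S})%type.

Definition sop_move (o : sop S) : move :=
  match o with Keep => MStay | Pop => MLeft | Push _ => MRight end.

Definition sop_pending (o : sop S) : option S :=
  if o is Push x then Some x else None.

Definition ctrans (q : cstate) (a : bool + A) (g : {ffun 'I_k -> option S}) :
    option (cstate * move * {ffun 'I_k -> option S * move} * option B) :=
  match q with
  | inl (q, v) =>
      if ft q v a [seq g j | j <- enum 'I_k] is Some (q', x) then
        let: (v', m, ops, o) := odflt (v, MStay, [::], None) x in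
        Some (inr (q', v', [ffun j : 'I_k => sop_pending (nth Keep ops j)]), m,
          [ffun j : 'I_k => (g j, sop_move (nth Keep ops j))], o)
      else None
  | inr (q, v, p) =>
      Some (inl (q, v), MStay,
        [ffun j => (if p j is Some x then Some x else g j, MStay)], None)
  end.

Definition compile : tm A B :=
  @TM A B k S cstate (inl (f0 F, v0))
    (fun q => if q is inl (_, v) then acc v else false) ctrans.

(** Only the cells up to the head are constrained, since a pop moves left and leaves the old symbol
    behind. The blank cell 0 makes an empty stack read as [None]. *)
Fixpoint tape_stack (f : nat -> option S) (s : seq S) : Prop :=
  if s is x :: s' then f (size s) = Some x /\ tape_stack f s' else f 0 = None.

Lemma tape_stack_eq f f' s :
  (forall i, i <= size s -> f i = f' i) -> tape_stack f s -> tape_stack f' s.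
Proof.
elim: s => [|x s IH] /= ff'; first by rewrite ff'.
move=> [fs fr]; split; first by rewrite -ff'.
by apply: IH fr => i hi; apply: ff'; lia.
Qed.

Lemma tape_stack_top f s : tape_stack f s -> f (size s) = ohead s.
Proof. by case: s => [|x s] //= []. Qed.

Variables (w : seq A) (ok : seq (seq S) -> Prop).

Definition represents (c : config compile) (q : fq F) (s : store) : Prop :=
  [/\ c_state c = inl (q, sv s), c_input c = spos s /\ spos s <= (size w).+1,
      size (sstk s) = k, c_output c = sout s
    & forall j : 'I_k, c_head c j = size (nth [::] (sstk s) j) /\
        tape_stack (c_tape c j) (nth [::] (sstk s) j)].

Lemma represents_obs c q s : represents c q s ->
  [seq [ffun j => c_tape c j (c_head c j)] j | j <- enum 'I_k] =
  map ohead (sstk s).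
Proof.
case=> _ _ szk _ hj; apply: (@eq_from_nth _ None).
  by rewrite size_map size_enum_ord size_map szk.
move=> i; rewrite size_map size_enum_ord => ik.
rewrite (nth_map (Ordinal ik)) ?size_enum_ord // (nth_map [::]) ?szk //.
have [hh ht] := hj (Ordinal ik).
have -> : nth (Ordinal ik) (enum 'I_k) i = Ordinal ik.
  by apply/val_inj; rewrite /= nth_enum_ord.
by rewrite ffunE hh tape_stack_top.
Qed.

Lemma represents_halt c q s : represents c q s -> fstep w q s = None ->
  next w c = None.
Proof.
move=> rep; have := represents_obs rep; case: rep => cq [ci _] _ _ _ obsE.
by rewrite /next /fstep /look cq ci /= obsE; case: (ft _ _ _ _) => [[]|].
Qed.

(** Every program step takes exactly two machine steps, whether or not it pushes. The heads of the
    intermediate [c1] are already at the new stack heights, so the space bound covers it too. *)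
Lemma represents_step c q s q' s' : represents c q s ->
  fstep w q s = Some (q', s') -> exists c1 c2,
  [/\ next w c = Some c1, next w c1 = Some c2, represents c2 q' s' &
      forall j, c_head c1 j = size (nth [::] (sstk s') j)].
Proof.
move=> rep; have := represents_obs rep; case: rep => cq [ci cis] szk co hj obsE.
rewrite /fstep /look; case E: (ft _ _ _ _) => [[q1 x]|] //= [<- <-] {q' s'}.
(* A silent transition has the effect of the neutral action, because the input position is within
   range and there are exactly [k] stacks. Both kinds of transition are then treated at once. *)
set y := odflt (sv s, MStay, [::], None) x.
have -> : (if x is Some a then doact w a s else s) = doact w y s.
  rewrite /y; case: x {E y} => //=; case: s cq ci cis szk co hj obsE => v p st o /=.
  move=> _ _ ps szk _ _ _; congr Store; first by rewrite /shift; lia.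
  rewrite -{1}(mkseq_nth [::] st) szk; apply: eq_mkseq => j.
  by rewrite nth_nil.
rewrite /next cq ci /= obsE E -/y.
case: y => [[[v' m] ops] o] {E x}.
eexists; eexists; split; first by []; first by [].
- split=> //=; [split=> //; lia | by rewrite size_mkseq | |].
    by rewrite co.
  move=> j; rewrite nth_mkseq //; have [hh ht] := hj j.
  rewrite !ffunE /=; split.
    rewrite hh; case: (nth Keep ops j) => [||x] //=; first by rewrite size_behead.
  rewrite hh; case: (nth Keep ops j) => [||x] /=.
  + by apply: tape_stack_eq ht => i _; case: eqP => [->|//]; rewrite eqxx.
  + apply: (@tape_stack_eq (c_tape c j)) => [i _|].
      by case: eqP => [->|_]; case: eqP => [->|].
    by case: (nth [::] _ _) ht => //= ? ? [].
  + rewrite eqxx; split=> //; apply: tape_stack_eq ht => i hi.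
    by case: eqP => [?|_]; [lia | case: eqP => [->|]].
- move=> j /=; rewrite nth_mkseq // !ffunE; have [hh ht] := hj j.
  by rewrite hh; case: (nth Keep ops j) => [||x] //=; rewrite size_behead.
Qed.

Lemma runs_compile q s n q' s' t c :
  runs w ok q s n q' s' -> run compile w t = Some c -> represents c q s ->
  exists c', [/\ run compile w (t + 2 * n) = Some c', represents c' q' s' &
    forall i c1, t <= i <= t + 2 * n -> run compile w i = Some c1 ->
    exists2 ss, ok ss & forall j, c_head c1 j = size (nth [::] ss j)].
Proof.
move=> R; elim: R t c => [{}q {}s oks|{}q {}s q1 s1 {}n q2 s2 oks st R IH] t c tc rep.
  exists c; split=> //; first by rewrite addn0.
  move=> i c1 hi; have -> : i = t by lia.
  rewrite tc => -[<-]; exists (sstk s) => // j.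
  by case: rep => _ _ _ _ /(_ j) [].
have [c1 [c2 [n1 n2 rep2 h1]]] := represents_step rep st.
have t1 : run compile w t.+1 = Some c1 by rewrite (runS tc).
have t2 : run compile w t.+2 = Some c2 by rewrite (runS t1).
have [c' [r' rep' h']] := IH _ _ t2 rep2.
exists c'; split=> //; first by rewrite mulnS addnA addn2.
move=> i d hi di.
case: (ltngtP i t.+1) => hit.
- have ei : i = t by lia.
  move: di; rewrite ei tc => -[<-]; exists (sstk s) => // j.
  by case: rep => _ _ _ _ /(_ j) [].
- by apply: (h' i) => //; lia.
- move: di; rewrite hit t1 => -[<-]; exists (sstk s1) => //.
  exact: runs_okl R.
Qed.

(** The second conclusion concerns all reachable configurations: by determinism the one after [i]
    steps lies on the simulated run, and none exists after step [2 * n]. *)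
Theorem compile_exec n s' :
  exec w ok F (Store v0 0 (nseq k [::]) [::]) n s' ->
  (exists c : config compile,
    [/\ halts_with w (2 * n) c, c_output c = sout s' &
      tm_accept (c_state c) = acc (sv s')]) /\
  (forall i (c : config compile), run compile w i = Some c ->
    exists2 ss, ok ss & forall j, c_head c j = size (nth [::] ss j)).
Proof.
move=> [q [R e]].
have rep0 : represents (init compile) (f0 F) (Store v0 0 (nseq k [::]) [::]).
  by split; rewrite //= ?size_nseq // => j; rewrite nth_nseq ltn_ord.
have [c [rc rep h]] := @runs_compile _ _ _ _ _ 0 _ R erefl rep0.
have halt := represents_halt rep e.
split.
  by exists c; case: rep => /= -> _ _ -> _.
move=> i d rd; apply: (h i) => //; rewrite leq0n leqNgt; apply/negP => lt.
have : run compile w (2 * n).+1 = None by rewrite (runS rc).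
move=> rn; move: rd; rewrite -(subnK lt) /run iterD -/(run _ _ _) rn.
have -> // : forall m, iter m (obind (next (M := compile) w)) None = None.
by elim=> //= m ->.
Qed.

End Compile.
End Programs.

Arguments seqsF : simpl never.
Arguments exec_le_ifT {A B V S k w ok b F G s n s' t}.
Arguments exec_le_ifF {A B V S k w ok b F G s n s' t}.
Arguments exec_le_whileT {A B V S k w ok b F s n s1 m s2 t}.
Arguments exec_le_seqs {A B V S k w ok F Fs s n s1 m s2 t}.
Arguments exec_le_trans {A B V S k w ok F s t s' t'}.

Lemma input_at_cat (A : finType) (u v : seq A) :
  input_at (u ++ v) (size u).+1 = if v is a :: _ then inr a else inl true.
Proof. by rewrite /input_at onth_cat ltnn subnn; case: v. Qed.

Section CommonPrograms.

Variables (A B V S : finType) (k : nat).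

Definition moveA (m : move) : obs A V S (act B V S) :=
  fun v _ _ => (v, m, [::], None).

Definition nonempty (j : nat) : obs A V S bool := fun _ _ t => isSome (nth None t j).

Definition rewindF : frag A B V S :=
  whileF (fun _ a _ => a != inl false) (doF (moveA MLeft)).

(** Three steps per cell: one for the move and two for the loop. The same count governs the other
    scanning loops. *)
Lemma rewind_exec w (ok : seq (seq S) -> Prop) v p ss o :
  p <= (size w).+1 -> size ss = k -> ok ss ->
  exec_le k w ok rewindF (Store v p ss o) (3 * p) (Store v 0 ss o).
Proof.
move=> pw ssk okss; elim: p pw => [|p IH] pw; first exact: exec_le_whileN.
apply: (exec_le_whileT (n := 1) (s1 := Store v p ss o)).
- by rewrite /look /= /input_at; case: onth.
- apply: exec_le_do => //; rewrite /look /=; congr Store; first by lia.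
  rewrite -[LHS](mkseq_nth [::]) ssk; apply: eq_mkseq => j.
  by rewrite nth_nil.
- by apply: IH; apply: ltnW.
- by lia.
Qed.

End CommonPrograms.

Arguments moveA {A B V S} m.
Arguments nonempty {A V S} j.
Arguments rewindF {A B V S}.

(** * Saturation of a grammar along an automaton *)

Section DerivesTheory.

Variables (N Sigma : eqType) (G : cfg N Sigma).

Lemma derives_trans u v x : derives G u v -> derives G v x -> derives G u x.
Proof. by move=> uv; elim=> // y z _ uy yz; apply: derives_step uy yz. Qed.

Lemma derives1_catl p u v : derives1 G u v -> derives1 G (p ++ u) (p ++ v).
Proof.
move=> [l [r [A [rhs [Ar -> ->]]]]]; exists (p ++ l), r, A, rhs.
by rewrite -!catA.
Qed.

Lemma derives1_catr p u v : derives1 G u v -> derives1 G (u ++ p) (v ++ p).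
Proof.
move=> [l [r [A [rhs [Ar -> ->]]]]]; exists l, (r ++ p), A, rhs.
by rewrite -!catA.
Qed.

Lemma derives_cat u u' v v' :
  derives G u u' -> derives G v v' -> derives G (u ++ v) (u' ++ v').
Proof.
move=> uu' vv'; apply: (@derives_trans _ (u' ++ v)).
  elim: uu' => [|x y _ IH xy]; first exact: derives_refl.
  exact: derives_step IH (derives1_catr _ xy).
elim: vv' => [|x y _ IH xy]; first exact: derives_refl.
exact: derives_step IH (derives1_catl _ xy).
Qed.

Lemma derives_rule A rhs u :
  (A, rhs) \in cfg_rules G -> derives G rhs u -> derives G [:: inl A] u.
Proof.
move=> Ar; apply: derives_trans; apply: derives_step (derives_refl _ _) _.
by exists [::], [::], A, rhs; rewrite cats0.
Qed.

End DerivesTheory.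

(** * Relations on the states of the automaton and their least fixed point *)

Section Saturation.

Variables (Sigma : finType) (M : dfa Sigma).
Let Q := dfa_state M.
Notation rel := {set Q * Q}.
Notation symb := (seq bool + Sigma)%type.

Definition rel_id : rel := [set p | p.1 == p.2].

Definition rel_comp (r s : rel) : rel :=
  [set p | [exists q, ((p.1, q) \in r) && ((q, p.2) \in s)]].

Definition rel_term (a : Sigma) : rel := [set p | dfa_trans p.1 a == p.2].

Implicit Types (r s t : rel) (p q : Q).

Lemma in_rel_comp r s p q :
  reflect (exists2 x, (p, x) \in r & (x, q) \in s) ((p, q) \in rel_comp r s).
Proof.
rewrite inE; apply: (iffP existsP) => [[x /andP[? ?]]|[x ? ?]]; exists x => //.
exact/andP.
Qed.

Lemma rel_compA : associative rel_comp.
Proof.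
move=> r s t; apply/setP=> -[p q]; apply/in_rel_comp/in_rel_comp.
  move=> [x px /in_rel_comp [y xy yq]]; exists y => //.
  by apply/in_rel_comp; exists x.
move=> [x /in_rel_comp [y py yx] xq]; exists y => //.
by apply/in_rel_comp; exists x.
Qed.

Lemma rel_comp1r : left_id rel_id rel_comp.
Proof.
move=> r; apply/setP=> -[p q]; apply/in_rel_comp/idP => [[x]|pq].
  by rewrite inE /= => /eqP ->.
by exists p; rewrite // inE.
Qed.

Lemma rel_compr1 : right_id rel_id rel_comp.
Proof.
move=> r; apply/setP=> -[p q]; apply/in_rel_comp/idP => [[x xp]|pq].
  by rewrite inE /= => /eqP <-.
by exists q; rewrite // inE.
Qed.

Lemma rel_compS r r' s s' : r \subset r' -> s \subset s' ->
  rel_comp r s \subset rel_comp r' s'.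
Proof.
move=> /subsetP rr' /subsetP ss'; apply/subsetP=> -[p q] /in_rel_comp [x px xq].
by apply/in_rel_comp; exists x; auto.
Qed.

Definition sym_rel (al : seq bool -> rel) (x : symb) : rel :=
  match x with inl A => al A | inr a => rel_term a end.

(** A left fold, because the machine reads a right-hand side from left to right and keeps only the
    composite so far. *)
Definition body_rel (al : seq bool -> rel) (u : seq symb) : rel :=
  foldl (fun r x => rel_comp r (sym_rel al x)) rel_id u.

Lemma body_rel_foldl al r u :
  foldl (fun r x => rel_comp r (sym_rel al x)) r u = rel_comp r (body_rel al u).
Proof.
rewrite /body_rel; elim: u r => [|x u IH] r /=; first by rewrite rel_compr1.
by rewrite IH [in RHS]IH rel_comp1r rel_compA.
Qed.

Lemma body_rel_cat al u v :
  body_rel al (u ++ v) = rel_comp (body_rel al u) (body_rel al v).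
Proof. by rewrite {1}/body_rel foldl_cat body_rel_foldl. Qed.

Lemma body_rel_cons al x u :
  body_rel al (x :: u) = rel_comp (sym_rel al x) (body_rel al u).
Proof. by rewrite {1}/body_rel /= rel_comp1r body_rel_foldl. Qed.

Lemma body_relS (al be : seq bool -> rel) u : (forall A, al A \subset be A) ->
  body_rel al u \subset body_rel be u.
Proof.
move=> ab; elim: u => [|x u IH]; first exact: subxx.
by rewrite !body_rel_cons rel_compS //; case: x => /=.
Qed.

Lemma body_rel_term al w p q :
  ((p, q) \in body_rel al (map inr w)) = (foldl (@dfa_trans _ M) p w == q).
Proof.
elim: w p => [|a w IH] p /=; first by rewrite inE.
rewrite body_rel_cons; apply/in_rel_comp/eqP => [[x]|pq].
  by rewrite inE /= => /eqP <-; rewrite IH => /eqP.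
by exists (dfa_trans p a); rewrite ?inE // IH pq.
Qed.

(* The log of the saturation: an entry [(A, r)] asserts that every pair of [r]
   is linked by some word derived from [A]. *)
Notation log := (seq (seq bool * rel)).
Implicit Types (D : log) (A : seq bool).

(** Entries are appended and never replaced, so the current relation of a name is the union of all
    its entries. *)
Definition lookup (D : log) (A : seq bool) : rel :=
  foldl (fun r e => if e.1 == A then r :|: e.2 else r) set0 D.

Lemma lookupP D A (p : Q * Q) :
  reflect (exists2 r, (A, r) \in D & p \in r) (p \in lookup D A).
Proof.
rewrite /lookup; elim/last_ind: D => [|D [B r] IH].
  by rewrite inE; constructor=> -[].
rewrite foldl_rcons /=; case: eqP => [->|BA].
  apply: (iffP setUP) => [[/IH [s Ds ps]|pr]|[s]].
  - by exists s; rewrite // mem_rcons inE Ds orbT.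
  - by exists r; rewrite // mem_rcons mem_head.
  - rewrite mem_rcons inE => /orP [/eqP [->]|Ds] ps; first by right.
    by left; apply/IH; exists s.
apply: (iffP IH) => [[s Ds ps]|[s]].
  by exists s; rewrite // mem_rcons inE Ds orbT.
rewrite mem_rcons inE => /orP [/eqP [AB]|Ds] ps; first by case: BA.
by exists s.
Qed.

Lemma lookupS D D' A : {subset D <= D'} -> lookup D A \subset lookup D' A.
Proof.
move=> DD'; apply/subsetP=> p /lookupP [r /DD' Dr pr].
by apply/lookupP; exists r.
Qed.

Definition rule_step (D : log) (r : seq bool * seq symb) : log :=
  rcons D (r.1, body_rel (lookup D) r.2).

(** Each rule already sees the entries appended by the earlier rules of the same round, as happens
    on the machine with its single log. *)
Definition round (rs : seq (seq bool * seq symb)) (D : log) : log :=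
  foldl rule_step D rs.

Lemma round_sub (rs : seq (seq bool * seq symb)) D : {subset D <= round rs D}.
Proof.
rewrite /round; elim: rs D => [|r rs IH] D e De //=; apply: IH.
by rewrite mem_rcons inE De orbT.
Qed.

(** [D'] is the log in force when the rule [x] is processed; as it contains [D], a round achieves at
    least what a simultaneous application of all rules to [D] would. *)
Lemma round_mem (rs : seq (seq bool * seq symb)) D x : x \in rs ->
  exists2 D', {subset D <= D'} & (x.1, body_rel (lookup D') x.2) \in round rs D.
Proof.
rewrite /round; elim: rs D => [//|y rs IH] D; rewrite inE => /orP [/eqP <-|hx] /=.
  by exists D => //; apply: round_sub; rewrite mem_rcons mem_head.
have [D' sub mem] := IH (rule_step D y) hx; exists D' => // e De; apply: sub.
by rewrite mem_rcons inE De orbT.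
Qed.

Variable G : bcfg Sigma.
Let rs := cfg_rules G.

Definition log_sound (D : log) : Prop :=
  forall A r, (A, r) \in D -> forall p q, (p, q) \in r ->
  exists2 w, derives G [:: inl A] (map inr w) & foldl (@dfa_trans _ M) p w = q.

Lemma body_rel_sound D u p q : log_sound D -> (p, q) \in body_rel (lookup D) u ->
  exists2 w, derives G u (map inr w) & foldl (@dfa_trans _ M) p w = q.
Proof.
move=> sD; elim: u p => [|x u IH] p.
  by rewrite inE => /eqP /= <-; exists [::] => //; apply: derives_refl.
rewrite body_rel_cons => /in_rel_comp [y px /IH [w uw yq]].
have [w' xw' py] : exists2 w', derives G [:: x] (map inr w') &
    foldl (@dfa_trans _ M) p w' = y.
  case: x px => [A|a] /= px.
    by have /lookupP [r Dr] := px; apply: sD Dr _ _.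
  by exists [:: a]; [apply: derives_refl | move: px; rewrite inE => /eqP].
exists (w' ++ w); last by rewrite foldl_cat py.
by rewrite map_cat -cat1s; apply: derives_cat.
Qed.

Lemma round_sound D : log_sound D -> log_sound (round rs D).
Proof.
(* The remaining rules become a sublist of the grammar, so that the induction shortens the list
   while derivations still use all of [G]. *)
rewrite /round; have: {subset rs <= cfg_rules G} by [].
elim: rs D => [|[A u] rs' IH] D //= sub sD; apply: IH.
  by move=> x xr; apply: sub; rewrite inE xr orbT.
move=> B r; rewrite mem_rcons inE => /orP [/eqP [-> ->]|]; last exact: sD.
move=> p q /(body_rel_sound sD) [w uw pq]; exists w => //.
by apply: derives_rule uw; apply: sub; rewrite mem_head.
Qed.

Definition saturate (n : nat) : log := iter n (round rs) [::].

Lemma saturate_sound n : log_sound (saturate n).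
Proof. by elim: n => // n IH; apply: round_sound. Qed.

Lemma saturate_sub n m : n <= m -> {subset saturate n <= saturate m}.
Proof.
move=> /subnK <-; elim: (m - n) => // k IH e /IH; exact: round_sub.
Qed.

(** Facts are indexed by rules instead of nonterminals: names range over an infinite type, but only
    heads of rules can have a nonempty relation. The cardinal of [T] gives the number of rounds. *)
Let T : finType := ('I_(size rs) * (Q * Q))%type.
Let r0 : seq bool * seq symb := ([::], [::]).

Let fact_rel (X : {set T}) (A : seq bool) : rel :=
  [set p | [exists i : 'I_(size rs), ((nth r0 rs i).1 == A) && ((i, p) \in X)]].

(** The immediate-consequence operator; its least fixed point is the least solution of the
    inequalities for the relations. *)
Let conseq (X : {set T}) : {set T} :=
  [set x : T | x.2 \in body_rel (fact_rel X) (nth r0 rs x.1).2].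

Let conseq_mono (X Y : {set T}) : X \subset Y -> conseq X \subset conseq Y.
Proof.
move=> /subsetP XY; apply/subsetP=> x; rewrite !inE; apply/subsetP/body_relS.
move=> A; apply/subsetP=> p; rewrite !inE => /existsP [i /andP [iA /XY]] ?.
by apply/existsP; exists i; rewrite iA.
Qed.

(** Sequential rounds stay ahead of the simultaneous iteration, by [round_mem] and monotonicity. *)
Let iter_conseq_log n (i : 'I_(size rs)) (p : Q * Q) : (i, p) \in iter n conseq set0 ->
  p \in lookup (saturate n) (nth r0 rs i).1.
Proof.
elim: n i p => [|n IH] i p; first by rewrite inE.
have hr : nth r0 rs i \in rs by rewrite mem_nth.
rewrite /= inE /= => pin; have [D' sub mem] := round_mem (saturate n) hr.
apply/lookupP; exists (body_rel (lookup D') (nth r0 rs i).2) => //.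
apply: (subsetP (body_relS _ _)) pin => A.
apply: subset_trans (lookupS _ sub); apply/subsetP=> q; rewrite inE.
by move=> /existsP [j /andP [/eqP <- /IH]].
Qed.

(** Along a derivation the relation of the sentential form can only shrink: a step replaces the
    relation of [A] by that of [rhs], which the fixed point includes in it. The terminal word at the
    end contributes the pair [(p, q)]. *)
Let fact_complete u w : derives G u (map inr w) ->
  forall p q, foldl (@dfa_trans _ M) p w = q ->
  (p, q) \in body_rel (fact_rel (fixset conseq)) u.
Proof.
set al := fact_rel _ => uw p q pq.
have : (p, q) \in body_rel al (map inr w) by rewrite body_rel_term pq.
apply/subsetP; elim: uw => [|v v' _ IH vv']; first exact: subxx.
apply: subset_trans IH; case: vv' => l [r [A [rhs [Ar -> ->]]]].
rewrite !body_rel_cat body_rel_cons rel_compS // rel_compS //=.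
apply/subsetP=> x xr; rewrite inE; apply/existsP.
have hi : index (A, rhs) rs < size rs by rewrite index_mem.
exists (Ordinal hi); rewrite /= nth_index //= eqxx /=.
by rewrite -(fixsetK conseq_mono) inE /= nth_index.
Qed.

(** Soundness holds after any number of rounds; completeness asks for one round per element of [T],
    which is how often [fixset] iterates. *)
Theorem saturate_correct n : size rs * #|{: Q * Q}| <= n ->
  [exists f, dfa_final f &&
    ((dfa_start M, f) \in lookup (saturate n) (cfg_start G))] <->
  exists w, cfg_lang G w /\ dfa_accepts M w.
Proof.
move=> hn; split=> [/existsP [f /andP [ff /lookupP [r Dr pr]]]|[w [Gw Mw]]].
  have [w Gw Mw] := saturate_sound Dr pr; exists w; split=> //.
  by rewrite /dfa_accepts Mw.
apply/existsP; exists (foldl (@dfa_trans _ M) (dfa_start M) w).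
rewrite [dfa_final _]Mw /=.
have := fact_complete Gw erefl; rewrite body_rel_cons rel_compr1 => /(_ (dfa_start M)).
rewrite /= inE => /existsP [i /andP [/eqP <- hi]].
have hT : #|T| <= n by rewrite card_prod card_ord.
move: hi; rewrite /fixset => /iter_conseq_log.
by apply/subsetP/lookupS/saturate_sub.
Qed.

End Saturation.

(** * A polynomial-time decision procedure *)

Section PolynomialBounds.

(** The base [n.+1] is positive, so raising the exponent never lowers the bound, and sums as well as
    products may add the exponents. *)
Definition poly_bounded (f : nat -> nat) :=
  exists a d, forall n, f n <= a * n.+1 ^ d.

Lemma poly_bounded_const c : poly_bounded (fun=> c).
Proof. by exists c, 0 => n; rewrite muln1. Qed.

Lemma poly_bounded_id : poly_bounded id.
Proof. by exists 1, 1 => n; rewrite mul1n. Qed.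

Lemma poly_bounded_add f g :
  poly_bounded f -> poly_bounded g -> poly_bounded (fun n => f n + g n).
Proof.
move=> [a [d fd]] [b [e ge]]; exists (a + b), (d + e) => n.
rewrite mulnDl leq_add //.
  by apply: leq_trans (fd n) _; rewrite leq_mul2l leq_pexp2l ?leq_addr ?orbT.
by apply: leq_trans (ge n) _; rewrite leq_mul2l leq_pexp2l ?leq_addl ?orbT.
Qed.

Lemma poly_bounded_mul f g :
  poly_bounded f -> poly_bounded g -> poly_bounded (fun n => f n * g n).
Proof.
move=> [a [d fd]] [b [e ge]]; exists (a * b), (d + e) => n.
by rewrite expnD mulnACA leq_mul.
Qed.

Lemma poly_boundedE f : poly_bounded f ->
  exists k d, forall n, f n <= k * n ^ d + k.
Proof.
(* For positive [n], [n.+1 ^ d <= 2 ^ d * n ^ d]; the additive constant takes care of [n = 0]. *)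
move=> [a [d fd]]; exists (a * 2 ^ d), d => n; apply: leq_trans (fd n) _.
rewrite -[X in _ <= _ + X]muln1 -mulnDr -mulnA leq_mul2l; apply/orP; right.
case: n => [|n]; first by rewrite exp1n muln_gt0 expn_gt0 addn_gt0 orbT.
apply: leq_trans (_ : 2 ^ d * n.+1 ^ d <= _); last by rewrite leq_mul2l leq_addr orbT.
by rewrite -expnMn; case: (posnP d) => [->|d0] //; rewrite leq_exp2r; lia.
Qed.

End PolynomialBounds.

(** * Unique readability of encoded grammars *)

Section Encoding.

Variable Sigma : finType.
Notation symb := (seq bool + Sigma)%type.

Definition is_bit (x : gsym Sigma) := if x is GBit _ then true else false.
Definition is_term (x : gsym Sigma) := if x is GTerm _ then true else false.
Definition is_nonterm (x : gsym Sigma) := x == GNonterm.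
Definition is_rule (x : gsym Sigma) := x == GRule.

(** What follows a name must not begin with a bit: this is how the end of a name is recognised. *)
Definition no_bit (y : seq (gsym Sigma)) :=
  ~~ (if y is a :: _ then is_bit a else false).

Definition rule_or_end (y : seq (gsym Sigma)) :=
  if y is a :: _ then is_rule a else true.

Lemma no_bit_symbols (xs : seq symb) y : rule_or_end y ->
  no_bit (flatten (map (@encode_symbol _) xs) ++ y).
Proof.
case: xs => [|[A|a] xs] //=; rewrite /no_bit; case: y => // a y.
by rewrite /rule_or_end /is_rule => /eqP ->.
Qed.

Lemma rule_or_end_rules rs :
  rule_or_end (flatten (map (@encode_rule Sigma) rs)).
Proof. by case: rs => [|? ?] //=; rewrite /is_rule. Qed.

Lemma map_GBit_inj A B x y : no_bit x -> no_bit y ->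
  map (@GBit Sigma) A ++ x = map (@GBit Sigma) B ++ y -> A = B /\ x = y.
Proof.
move=> hx hy.
elim: A B => [|a A IH] [|b B] //=; [|move=> E; move: hy|].
- by move=> E; move: hx; rewrite E.
- by rewrite -E.
- by case=> -> /IH [-> ->].
Qed.

Lemma encode_symbols_inj (xs ys : seq symb) x y : rule_or_end x -> rule_or_end y ->
  flatten (map (@encode_symbol _) xs) ++ x = flatten (map (@encode_symbol _) ys) ++ y ->
  xs = ys /\ x = y.
Proof.
move=> hx hy; elim: xs ys => [|X xs IH] [|Y ys] //=.
- by case: Y => [B|b] /= E; move: hx; rewrite E.
- by case: X => [B|b] /= E; move: hy; rewrite -E.
case: X Y => [B|b] [C|c] //=.
  rewrite -!catA => -[/(@map_GBit_inj B C)].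
  by case=> [||-> /IH [-> ->]] //; apply: no_bit_symbols.
by case=> -> /IH [-> ->].
Qed.

(** The existential over grammars in [cfg_ip] thus has at most one candidate, which both membership
    and hardness rely on. *)
Lemma encode_cfg_inj : injective (@encode_cfg Sigma).
Proof.
move=> [A rs] [B ss] [/map_GBit_inj [||/= -> E]].
- by rewrite -[X in no_bit X]cat0s; apply: (@no_bit_symbols [::]); apply: rule_or_end_rules.
- by rewrite -[X in no_bit X]cat0s; apply: (@no_bit_symbols [::]); apply: rule_or_end_rules.
congr Cfg; elim: rs ss E => [|[C xs] rs IH] [|[D ys] ss] //= [].
rewrite -!catA => /(@map_GBit_inj C D).
case=> [||-> /encode_symbols_inj]; try exact/no_bit_symbols/rule_or_end_rules.
by case=> [||-> /IH ->] //; apply: rule_or_end_rules.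
Qed.

End Encoding.

Arguments is_bit {Sigma} x.
Arguments is_term {Sigma} x.
Arguments is_nonterm {Sigma} x.
Arguments is_rule {Sigma} x.

(** * The program that decides membership *)

Section Decider.

Variables (Sigma : finType) (M : dfa Sigma).
Let Q := dfa_state M.
Notation rel := {set Q * Q}.
Notation symb := (seq bool + Sigma)%type.
Notation log := (seq (seq bool * rel)).

(* The format automaton: the first component tells whether a rule has been
   seen; the second is [None] when a name must start, [Some true] inside a
   name and [Some false] after a terminal. *)
Definition format := option (bool * option bool).

Definition format_step (f : format) (a : gsym Sigma) : format :=
  match f, a with
  | Some (r, None), GNonterm => Some (r, Some true)
  | Some (r, Some true), GBit _ => Some (r, Some true)
  | Some (_, Some _), GRule => Some (true, None)
  | Some (true, Some _), GNonterm => Some (true, Some true)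
  | Some (true, Some _), GTerm _ => Some (true, Some false)
  | _, _ => None
  end.

Definition format_ok (f : format) : bool := if f is Some (_, Some _) then true else false.

(** The format state, a flag telling whether the current name comparison still agrees, the composite
    of the right-hand side read so far, and the relation collected by a lookup. *)
Definition vars : finType := (format * bool * rel * rel)%type.
(** A log entry is the bits of a name followed by a relation. Stack 0 holds the log with the latest
    entry on top, stack 1 the part of it still to be scanned, stack 2 the remaining rounds in
    unary. *)
Definition cell : finType := (bool + rel)%type.

Notation obs := (obs (gsym Sigma) vars cell).
Notation action := (act void vars cell).
Notation frag := (frag (gsym Sigma) void vars cell).

Definition on_input (b : pred (gsym Sigma)) : obs bool :=
  fun _ a _ => if a is inr x then b x else false.

Definition scanF (m : move) (b : pred (gsym Sigma)) : frag :=
  whileF (on_input b) (doF (moveA m)).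

Definition unpileA : obs action := fun v _ t =>
  (v, MStay, [:: Pop; if nth None t 0 is Some x then Push x else Keep], None).

Definition initA : obs action := fun v _ _ =>
  let: (f, _, c, _) := v in ((f, true, c, set0), MRight, [::], None).

Definition on_bit : obs bool := fun _ _ t =>
  if nth None t 1 is Some (inl _) then true else false.

(** The input head advances only while the names agree. A mismatch clears the flag for the rest of
    the entry, and the bits go back to stack 0 in any case. *)
Definition bitA : obs action := fun v a t =>
  let: (f, fl, c, r) := v in
  let b := if nth None t 1 is Some (inl b) then b else false in
  let fl' := fl && (a == inr (GBit b)) in
  ((f, fl', c, r), if fl' then MRight else MStay, [:: Push (inl b); Pop], None).

(** The names are equal if the flag survived and the input name is exhausted as well. The move to
    the left matters: the head may have stopped on the marker of the next name, where the following
    scan for a marker would end too early. *)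
Definition entryA : obs action := fun v a t =>
  let: (f, fl, c, r) := v in
  let s := if nth None t 1 is Some (inr s) then s else set0 in
  ((f, true, c, if fl && ~~ (if a is inr x then is_bit x else false)
                then r :|: s else r), MLeft, [:: Push (inr s); Pop], None).

Definition matchF : frag :=
  whileF (nonempty 1)
    (ifF on_bit (doF bitA)
       (seqsF [:: doF entryA; scanF MLeft (fun x => ~~ is_nonterm x);
                  doF (moveA MRight)])).

(* From the marker of a name, collect in the last variable the relations that
   are logged for this name. *)
Definition lookupF : frag :=
  seqsF [:: whileF (nonempty 0) (doF unpileA); doF initA; matchF;
            doF (moveA MLeft)].

Definition termA : obs action := fun v a _ =>
  let: (f, fl, c, r) := v in
  ((f, fl, if a is inr (GTerm x) then rel_comp c (rel_term M x) else c, r),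
   MRight, [::], None).

Definition nontermA : obs action := fun v _ _ =>
  let: (f, fl, c, r) := v in ((f, fl, rel_comp c r, r), MRight, [::], None).

Definition symF : frag :=
  ifF (on_input is_term) (doF termA)
    (seqsF [:: lookupF; doF nontermA; scanF MRight is_bit]).

Definition ruleA : obs action := fun v _ _ =>
  let: (f, fl, _, r) := v in ((f, fl, rel_id M, r), MRight, [::], None).

Definition push_bitA : obs action := fun v a _ =>
  (v, MRight, [:: if a is inr (GBit b) then Push (inl b) else Keep], None).

Definition push_relA : obs action := fun v _ _ =>
  (v, MStay, [:: Push (inr v.1.2)], None).

(** The head name is copied in a second pass, because an unfinished entry must not lie on the log
    during the lookups of the right-hand side. As in [entryA], one step to the left precedes the
    backward scan, which could otherwise stop at the next rule. *)
Definition ruleF : frag :=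
  seqsF [:: doF ruleA; doF (moveA MRight); scanF MRight is_bit;
    whileF (on_input (fun x => is_term x || is_nonterm x)) symF;
    doF (moveA MLeft); scanF MLeft (fun x => ~~ is_rule x);
    doF (moveA MRight); doF (moveA MRight);
    whileF (on_input is_bit) (doF push_bitA); doF push_relA;
    scanF MRight (fun x => ~~ is_rule x)].

Definition roundF : frag :=
  seqsF [:: rewindF; doF (moveA MRight);
    scanF MRight (fun x => ~~ is_rule x); whileF (on_input is_rule) ruleF].

Definition tickA : obs action := fun v _ _ =>
  (v, MStay, [:: Keep; Keep; Pop], None).

Definition mainF : frag :=
  seqsF [:: whileF (nonempty 2) (seqsF [:: doF tickA; roundF]);
    rewindF; doF (moveA MRight); lookupF].

Definition formatA : obs action := fun v a _ =>
  let: (f, fl, c, r) := v in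
  ((if a is inr x then format_step f x else f, fl, c, r), MRight, [::], None).

Definition tallyA : obs action := fun v _ _ =>
  (v, MStay, [:: Keep; Keep; Push (inl false)], None).

(** Besides checking the format, the pass piles up [c] tallies per letter. They serve as the counter
    of rounds. *)
Definition readF (c : nat) : frag :=
  seqsF [:: doF (moveA MRight);
    whileF (on_input predT) (seqsF (rcons (nseq c (doF tallyA)) (doF formatA)))].

Definition deciderF : frag :=
  seqsF [:: readF #|{: Q * Q}|;
    ifF (fun v _ _ => format_ok v.1.1.1) mainF (skipF _ _ _ _)].

Definition decider_acc (v : vars) : bool :=
  format_ok v.1.1.1 &&
  [exists f, dfa_final f && ((dfa_start M, f) \in v.2)].

(** * Correctness and running time of the decider *)

Section Execution.

Variable w : seq (gsym Sigma).
Let n := size w.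

Notation E := (@exec_le _ _ _ _ 3 w (fun _ => True)).

Definition st (v : vars) p D1 D2 C : store void vars cell :=
  Store v p [:: D1; D2; C] [::].

Lemma scan_right b v u x y D1 D2 C : w = u ++ x ++ y -> all b x ->
  ~~ (if y is a :: _ then b a else false) ->
  E (scanF MRight b) (st v (size u).+1 D1 D2 C) (3 * size x)
    (st v (size u + size x).+1 D1 D2 C).
Proof.
elim: x u => [|a x IH] u /= wE => [_|/andP [ba bx]] by_.
  rewrite addn0; apply: exec_le_whileN => //.
  by rewrite /look /= wE input_at_cat /on_input; case: (y) by_ => // ? ? /negbTE.
have sz : size w = (size u + size x + size y).+1 by rewrite wE size_cat /= size_cat; lia.
apply: (exec_le_whileT (n := 1) (s1 := st v (size (rcons u a)).+1 D1 D2 C)).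
- by rewrite /look /= wE input_at_cat /on_input.
- apply: exec_le_do => //; rewrite /look /= /st; congr Store.
  by rewrite size_rcons; lia.
- have := IH (rcons u a); rewrite size_rcons addSnnS; apply=> //.
  by rewrite cat_rcons.
- by lia.
Qed.

Lemma scan_left b v u a x y i D1 D2 C : w = u ++ a :: x ++ y -> all b x ->
  ~~ b a -> i <= size x ->
  E (scanF MLeft b) (st v (size u + i).+1 D1 D2 C) (3 * i)
    (st v (size u).+1 D1 D2 C).
Proof.
move=> wE bx ba; elim: i => [|i IH] ix.
  rewrite addn0; apply: exec_le_whileN => //.
  by rewrite /look /= wE input_at_cat /on_input (negbTE ba).
have sz : size w = (size u + size x + size y).+1.
  by rewrite wE size_cat /= size_cat; lia.
apply: (exec_le_whileT (n := 1) (s1 := st v (size u + i).+1 D1 D2 C)).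
- have wE' : w = (u ++ a :: take i x) ++ nth a x i :: drop i.+1 x ++ y.
    by rewrite wE -{1}(cat_take_drop i x) (drop_nth a ix) -!catA.
  have -> : size u + i.+1 = size (u ++ a :: take i x).
    by rewrite size_cat /= size_takel // ltnW.
  rewrite /look /= wE' input_at_cat /on_input.
  by move/all_nthP: bx; apply.
- by apply: exec_le_do => //; rewrite /look /= /st; congr Store; lia.
- by apply: IH; lia.
- by lia.
Qed.

Lemma rewind v p D1 D2 C : p <= n.+1 ->
  E rewindF (st v p D1 D2 C) (3 * n.+1) (st v 0 D1 D2 C).
Proof.
move=> pn; apply: (exec_le_trans (t := 3 * p)); last by lia.
exact: rewind_exec.
Qed.

Lemma unpile v p D1 D2 C : p <= n.+1 ->
  E (whileF (nonempty 0) (doF unpileA)) (st v p D1 D2 C) (3 * size D1)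
    (st v p [::] (catrev D1 D2) C).
Proof.
move=> pn; elim: D1 D2 => [|x D1 IH] D2; first exact: exec_le_whileN.
apply: (exec_le_whileT (n := 1) (s1 := st v p D1 (x :: D2) C)) => //.
- by apply: exec_le_do => //; rewrite /look /= /st; congr Store; lia.
- by rewrite /=; lia.
Qed.

Definition log_cells (D : log) : seq cell :=
  flatten [seq rcons (map inl e.1) (inr e.2) | e <- D].

Section Lookup.

Variables (u : seq (gsym Sigma)) (A : seq bool) (y : seq (gsym Sigma)).
Hypothesis wE : w = u ++ GNonterm :: map GBit A ++ y.
Hypothesis y0 : ~~ (if y is a :: _ then is_bit a else false).
Variables (f : format) (c : rel) (C : seq cell).

Let pos i := (size u + i).+2.

Let szw : n = (size u + size A + size y).+1.
Proof. by rewrite /n wE size_cat /= size_cat size_map; lia. Qed.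

Let input_name A1 A2 : A = A1 ++ A2 ->
  input_at w (pos (size A1)) =
  if map GBit A2 ++ y is a :: _ then inr a else inl true.
Proof.
move=> AE.
have -> : w = (u ++ GNonterm :: map GBit A1) ++ map GBit A2 ++ y.
  by rewrite wE AE map_cat -!catA.
have -> : pos (size A1) = (size (u ++ GNonterm :: @map _ (gsym Sigma) GBit A1)).+1.
  by rewrite size_cat /= size_map /pos addnS.
exact: input_at_cat.
Qed.

(** Stated with a continuation, since the final input position depends on where the first mismatch
    occurs. The rest of the run only uses that a surviving flag together with an exhausted input
    name means equality. *)
Lemma match_bits r fl A1 A2 B D1 D2 t s : A = A1 ++ A2 ->
  (forall fl' A1' A2', A = A1' ++ A2' ->
    fl' && nilp A2' = fl && (B == A2) ->
    E matchF (st (f, fl', c, r) (pos (size A1')) (catrev (map inl B) D1) D2 C)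
      t s) ->
  E matchF (st (f, fl, c, r) (pos (size A1)) D1 (map inl B ++ D2) C)
    (t + 4 * size B) s.
Proof.
elim: B fl A1 A2 D1 => [|b B IH] fl A1 A2 D1 AE h.
  by rewrite addn0; apply: (h _ _ _ AE); case: A2 {AE h}.
have szA : size A = size A1 + size A2 by rewrite AE size_cat.
pose fl1 := fl && (input_at w (pos (size A1)) == inr (GBit b)).
pose p1 := if fl1 then pos (size A1).+1 else pos (size A1).
apply: (exec_le_whileT (n := 2)
  (s1 := st (f, fl1, c, r) p1 (inl b :: D1) (map inl B ++ D2) C)) => //.
- apply: (exec_le_ifT (n := 1)) => //.
  apply: exec_le_do => //; rewrite /look /= -/fl1 /st; congr Store.
  (* If the flag survives, the scanned letter is a bit, hence belongs to the name and not to [y]; so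
     the move to the right is not cut off at the right marker. *)
  rewrite /p1; case E1: fl1; last by rewrite /pos /=; lia.
  move: E1; rewrite /fl1 (input_name AE) /pos /= => /andP [_].
  case: (A2) szA => [|? A3] /= => [_|?]; last by lia.
  by case: (y) y0 => // a ? + /eqP [?]; subst a.
- rewrite /p1; case E1: fl1.
    have [A3 A2E] : exists A3, A2 = b :: A3.
      move: E1; rewrite /fl1 (input_name AE) => /andP [_].
      case: (A2) => [|a A3] /=; last by move=> /eqP [->]; exists A3.
      by case: (y) y0 => // a ? + /eqP [?]; subst a.
    have -> : (size A1).+1 = size (rcons A1 b) by rewrite size_rcons.
    apply: (IH _ _ A3); first by rewrite cat_rcons -A2E.
    move=> fl' A1' A2' AE' flE; apply: (h _ _ _ AE'). rewrite flE A2E eqseq_cons eqxx.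
    by case/andP: E1 => ->.
  apply: (IH _ _ A2) => // fl' A1' A2' AE' flE; apply: (h _ _ _ AE'); rewrite flE /=.
  symmetry; apply: contraFF E1 => /andP [flT /eqP A2E].
  by rewrite /fl1 flT (input_name AE) -A2E /= eqxx.
- by rewrite /=; lia.
Qed.

(** An entry costs four steps per bit of its name plus a scan back over an input name of length at
    most [n]. It has at least one cell more than bits, so [3 * n + 20] steps per cell pay for
    everything. *)
Lemma match_log r D D1 :
  E matchF (st (f, true, c, r) (pos 0) D1 (log_cells D) C)
    (size (log_cells D) * (3 * n + 20))
    (st (f, true, c, foldl (fun r e => if e.1 == A then r :|: e.2 else r) r D)
       (pos 0) (catrev (log_cells D) D1) [::] C).
Proof.
elim: D r D1 => [|[B s] D IH] r D1; first exact: exec_le_whileN.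
rewrite /log_cells /= -/(log_cells D) cat_rcons catrev_catl /= size_cat /=.
set r' := if B == A then _ else _; rewrite size_map.
pose t := size (log_cells D) * (3 * n + 20) + (3 * n + 20).
apply: (exec_le_trans (t := t + 4 * size B)); last first.
  by rewrite /t -mulSnr mulnDl addnC leq_add2r mulnC leq_mul2l; lia.
apply: (@match_bits _ _ [::] A) => // fl A1 A2 AE flE.
have szA : size A = size A1 + size A2 by rewrite AE size_cat.
pose s1 i := st (f, true, c, r') i (inr s :: catrev (map inl B) D1) (log_cells D) C.
apply: (exec_le_whileT (n := (3 * size A1 + 10)) (s1 := s1 (pos 0))) => //.
- apply: (exec_le_ifF (n := 3 * size A1 + 9)) => //; last by lia.
    apply: (exec_le_seqs (n := 1) (s1 := s1 (size u + size A1).+1)) => //.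
      apply: exec_le_do => //; rewrite /look /= /st; congr Store.
      + congr (_, _, _); rewrite (input_name AE) /r'.
        rewrite /= in flE; rewrite -flE.
        by case: (A2) => [|a A3] //=; case: (y) y0 => [|a y'] //= ->.
      + by rewrite /pos; lia.
    apply: (exec_le_seqs (s1 := s1 (size u).+1)).
    + have := scan_left (f, true, c, r') (i := size A1)
        (inr s :: catrev (map inl B) D1) (log_cells D) C wE.
      apply=> //; last by rewrite size_map szA leq_addr.
      by rewrite all_map; apply/allP.
    + apply: (exec_le_seqs (n := 1) (s1 := s1 (pos 0))); last first.
      * exact: leqnn.
      * exact: exec_le_nil.
      * apply: exec_le_do => //; rewrite /look /= /st; congr Store.
        by rewrite /pos; lia.
    + exact: leqnn.
    + by lia.
- exact: IH.
- by rewrite /t; nia.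
Qed.

Lemma lookup_exec b r D :
  E lookupF (st (f, b, c, r) (size u).+1 (rev (log_cells D)) [::] C)
    ((size (log_cells D)).+1 * (3 * n + 30))
    (st (f, true, c, lookup D A) (size u).+1 (rev (log_cells D)) [::] C).
Proof.
apply: exec_le_seqs; [by apply: unpile; lia | | ].
  (* Unpiling reverses the stack, so stack 1 presents the oldest entry first, in the order of the
     fold in [lookup]. *)
  rewrite -[catrev _ _]/(rev (rev _)) revK.
  apply: (exec_le_seqs (n := 1)
    (s1 := st (f, true, c, set0) (pos 0) [::] (log_cells D) C)).
  - by apply: exec_le_do => //; rewrite /look /= /st; congr Store; rewrite /pos; lia.
  - apply: exec_le_seqs; [exact: match_log | | exact: leqnn].
    apply: (exec_le_seqs (n := 1)
      (s1 := st (f, true, c, lookup D A) (size u).+1 (rev (log_cells D)) [::] C)).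
    + by apply: exec_le_do => //; rewrite /look /= /st; congr Store; rewrite /pos; lia.
    + exact: exec_le_nil.
    + exact: leqnn.
  - exact: leqnn.
by rewrite size_rev; nia.
Qed.

End Lookup.

Section Rules.

Variables (f : format) (C : seq cell) (m : nat).

(** Bounds the treatment of one symbol: a lookup in a log of at most [m] cells and a scan over the
    name. *)
Let K := m.+1 * (6 * n + 50).

Lemma sym_exec u x y b c r D : w = u ++ encode_symbol x ++ y -> no_bit y ->
  size (log_cells D) <= m -> exists b' r',
  E symF (st (f, b, c, r) (size u).+1 (rev (log_cells D)) [::] C) K
    (st (f, b', rel_comp c (sym_rel (lookup D) x), r')
       (size (u ++ encode_symbol x)).+1 (rev (log_cells D)) [::] C).
Proof.
move=> + y0 Dm; case: x => [A|a] /= wE; last first.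
  exists b, r; apply: (exec_le_ifT (n := 1)); last by rewrite /K; nia.
    by rewrite /look /= wE input_at_cat.
  apply: exec_le_do => //; rewrite /look /= wE input_at_cat /st; congr Store.
  by rewrite !size_cat /=; lia.
have szw : n = (size u + size A + size y).+1.
  by rewrite /n wE size_cat /= size_cat size_map; lia.
exists true, (lookup D A).
have la : (size (log_cells D)).+1 * (3 * n + 30) <= m.+1 * (3 * n + 30).
  by rewrite leq_mul2r ltnS Dm orbT.
apply: (exec_le_ifF (n := (size (log_cells D)).+1 * (3 * n + 30) + 3 * n + 10)).
- by rewrite /look /= wE input_at_cat.
- apply: exec_le_seqs; first exact: lookup_exec wE y0 _ _ _ _ _ _.
    apply: (exec_le_seqs (n := 1)
      (s1 := st (f, true, rel_comp c (lookup D A), lookup D A) (size u).+2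
               (rev (log_cells D)) [::] C)).
    + by apply: exec_le_do => //; rewrite /look /= /st; congr Store; lia.
    + apply: exec_le_seqs; last exact: leqnn; last exact: exec_le_nil.
      have := scan_right (f, true, rel_comp c (lookup D A), lookup D A)
        (b := is_bit) (u := rcons u GNonterm) (x := map GBit A) (y := y)
        (rev (log_cells D)) [::] C.
      rewrite size_rcons cat_rcons size_cat /= size_map addSnnS.
      by apply=> //; rewrite all_map; apply/allP.
    + exact: leqnn.
  by lia.
- by rewrite /K; nia.
Qed.

Lemma body_exec u (xs : seq symb) y b c r D :
  w = u ++ flatten (map (@encode_symbol _) xs) ++ y -> rule_or_end y ->
  size (log_cells D) <= m -> exists b' r',
  E (whileF (on_input (fun x => is_term x || is_nonterm x)) symF)
    (st (f, b, c, r) (size u).+1 (rev (log_cells D)) [::] C) (size xs * (K + 2))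
    (st (f, b', foldl (fun r x => rel_comp r (sym_rel (lookup D) x)) c xs, r')
       (size (u ++ flatten (map (@encode_symbol _) xs))).+1
       (rev (log_cells D)) [::] C).
Proof.
move=> + ye Dm; elim: xs u b c r => [|x xs IH] u b c r /= wE.
  exists b, r; rewrite cats0; apply: exec_le_whileN => //.
  rewrite /look /= wE input_at_cat /on_input; case: (y) ye => [|a y'] //=.
  by rewrite /is_rule => /eqP ->.
have wE1 : w = u ++ encode_symbol x ++ flatten (map (@encode_symbol _) xs) ++ y.
  by rewrite wE -catA.
have nb := no_bit_symbols xs ye.
have [b1 [r1 e1]] := sym_exec b c r wE1 nb Dm.
have [|b2 [r2 e2]] := IH (u ++ encode_symbol x) b1
  (rel_comp c (sym_rel (lookup D) x)) r1; first by rewrite -catA wE1.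
exists b2, r2; rewrite catA; apply: (exec_le_whileT _ e1 e2); last first.
  by rewrite mulSn; lia.
by rewrite /look /= wE1 input_at_cat; case: (x).
Qed.

Lemma push_bits v u A y L : w = u ++ map GBit A ++ y -> no_bit y ->
  E (whileF (on_input is_bit) (doF push_bitA)) (st v (size u).+1 L [::] C)
    (3 * size A) (st v (size u + size A).+1 (catrev (map inl A) L) [::] C).
Proof.
elim: A u L => [|a A IH] u L /= wE y0.
  rewrite addn0; apply: exec_le_whileN => //.
  by rewrite /look /= wE input_at_cat /on_input; case: (y) y0 => // ? ? /negbTE.
have sz : size w = (size u + size A + size y).+1.
  by rewrite wE size_cat /= size_cat size_map; lia.
apply: (exec_le_whileT (n := 1)
  (s1 := st v (size (rcons u (GBit a))).+1 (inl a :: L) [::] C)).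
- by rewrite /look /= wE input_at_cat.
- apply: exec_le_do => //; rewrite /look wE input_at_cat -wE /= /st; congr Store.
  by rewrite size_rcons; lia.
- have := IH (rcons u (GBit a)) (inl a :: L); rewrite cat_rcons size_rcons.
  by rewrite addSnnS; apply.
- by lia.
Qed.

Lemma rule_exec u x y b c r D : w = u ++ encode_rule x ++ y -> rule_or_end y ->
  size (log_cells D) <= m -> exists b' c' r',
  E ruleF (st (f, b, c, r) (size u).+1 (rev (log_cells D)) [::] C)
    (size (encode_rule x) * (K + 40))
    (st (f, b', c', r') (size (u ++ encode_rule x)).+1
       (rev (log_cells (rule_step D x))) [::] C).
Proof.
move=> wE ye Dm; case: x wE => A xs wE.
pose z := flatten (map (@encode_symbol Sigma) xs).
have wE1 : w = (u ++ GRule :: encode_nonterm Sigma A) ++ z ++ y.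
  by rewrite wE /= -!catA.
have wE2 : w = (rcons (rcons u GRule) GNonterm) ++ map GBit A ++ z ++ y.
  by rewrite wE1 /= !cat_rcons -!catA.
have zy : no_bit (z ++ y) := no_bit_symbols xs ye.
have szE : size (encode_rule (A, xs)) = (size A + size z).+2.
  by rewrite /= size_cat /= size_map.
(* A symbol takes at least one letter, so the cost per symbol can be charged to the length of the
   encoded rule. *)
have szxs : size xs <= size z.
  rewrite /z; elim: (xs) => //= x xs' IH; rewrite size_cat.
  by case: x => /= *; lia.
have szw : n = size u + (size A + size z).+2 + size y.
  by rewrite /n wE !size_cat szE addnA.
pose L := rev (log_cells D).
pose c1 := body_rel (lookup D) xs.
have [b1 [r1 e1]] := body_exec b (rel_id M) r wE1 ye Dm.
exists b1, c1, r1.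
pose v1 := (f, b1, c1, r1); pose p0 := (size u).+1; pose p1 := p0 + (size A + size z).+2.
have p1E : (size (u ++ encode_rule (A, xs))).+1 = p1.
  by rewrite size_cat szE /p1 /p0 addSn.
have szhd : (size (u ++ GRule :: encode_nonterm Sigma A)).+1 = p0.+2 + size A.
  by rewrite size_cat /= size_map /p0; lia.
have {}e1 : E (whileF (on_input (fun x => is_term x || is_nonterm x)) symF)
    (st (f, b, rel_id M, r) (p0.+2 + size A) L [::] C) (size xs * (K + 2))
    (st v1 p1 L [::] C).
  by move: e1; rewrite szhd -p1E /= -catA.
have e2 := push_bits v1 L wE2 zy; rewrite !size_rcons -/p0 -addSn in e2.
have e3 : E (scanF MRight is_bit) (st (f, b, rel_id M, r) p0.+2 L [::] C)
    (3 * size A) (st (f, b, rel_id M, r) (p0.+2 + size A) L [::] C).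
  have := scan_right (f, b, rel_id M, r) (b := is_bit) L [::] C wE2.
  rewrite !size_rcons size_map -/p0 -addSn; apply=> //.
  by rewrite all_map; apply/allP.
have e4 : E (scanF MLeft (fun x => ~~ is_rule x)) (st v1 p1.-1 L [::] C)
    (3 * (size A + size z).+1) (st v1 p0 L [::] C).
  have wE3 : w = u ++ GRule :: (encode_nonterm Sigma A ++ z) ++ y.
    by rewrite wE.
  have := scan_left (b := fun x => ~~ is_rule x) v1 (i := (size A + size z).+1)
    L [::] C wE3.
  rewrite -addSn -/p0 /p1 !addnS; apply=> //; last by rewrite /= size_cat size_map.
  rewrite /= all_cat all_map /z; apply/andP; split; first exact/allP.
  elim: (xs) => // x xs' IH; rewrite /= all_cat IH andbT; case: x => //= ?.
  by rewrite all_map; apply/allP.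
pose L' := inr c1 :: catrev (map inl A) L.
have LE : rev (log_cells (rule_step D (A, xs))) = L'.
  rewrite /rule_step /log_cells map_rcons flatten_rcons /= -/(log_cells D).
  by rewrite rev_cat rev_rcons /L' catrevE /L.
have e5 : E (scanF MRight (fun x => ~~ is_rule x)) (st v1 (p0.+2 + size A) L' [::] C)
    (3 * size z) (st v1 p1 L' [::] C).
  have := scan_right v1 (b := fun x => ~~ is_rule x) L' [::] C wE1.
  rewrite -addSn szhd /p1 -addnA !addSn -!addnS; apply=> //.
    rewrite /z; elim: (xs) => // x xs' IH; rewrite /= all_cat IH andbT; case: x => //= ?.
    by rewrite all_map; apply/allP.
  by case: (y) ye => //= a y' ->.
rewrite p1E LE.
have sz1 : size w = size u + (size A + size z).+2 + size y := szw.
apply: (exec_le_seqs (n := 1) (s1 := st (f, b, rel_id M, r) p0.+1 L [::] C)).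
  by apply: exec_le_do => //; rewrite /look /= /st; congr Store; rewrite /p0; lia.
apply: (exec_le_seqs (n := 1) (s1 := st (f, b, rel_id M, r) p0.+2 L [::] C)).
  by apply: exec_le_do => //; rewrite /look /= /st; congr Store; rewrite /p0; lia.
apply: (exec_le_seqs e3).
apply: (exec_le_seqs e1).
apply: (exec_le_seqs (n := 1) (s1 := st v1 p1.-1 L [::] C)).
  by apply: exec_le_do => //; rewrite /look /= /st; congr Store; rewrite /p1 /p0; lia.
apply: (exec_le_seqs e4).
apply: (exec_le_seqs (n := 1) (s1 := st v1 p0.+1 L [::] C)).
  by apply: exec_le_do => //; rewrite /look /= /st; congr Store; rewrite /p0; lia.
apply: (exec_le_seqs (n := 1) (s1 := st v1 p0.+2 L [::] C)).
  by apply: exec_le_do => //; rewrite /look /= /st; congr Store; rewrite /p0; lia.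
apply: (exec_le_seqs e2).
apply: (exec_le_seqs (n := 1) (s1 := st v1 (p0.+2 + size A) L' [::] C)).
  by apply: exec_le_do => //; rewrite /look /= /st; congr Store; rewrite /p0; lia.
apply: (exec_le_seqs e5); first exact: exec_le_nil.
all: try exact: leqnn.
have : size xs * (K + 2) <= size z * (K + 2) by rewrite leq_mul2r szxs orbT.
by rewrite szE; move: K => K' h; nia.
Qed.

Lemma size_log_step D x :
  size (log_cells (rule_step D x)) = size (log_cells D) + (size x.1).+1.
Proof.
rewrite /log_cells /rule_step map_rcons flatten_rcons size_cat.
by rewrite [in LHS]size_rcons size_map.
Qed.

Lemma round_body_exec u (rs : seq (seq bool * seq symb)) b c r D :
  w = u ++ flatten (map (@encode_rule _) rs) ->
  size (log_cells (round rs D)) <= m -> exists b' c' r',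
  E (whileF (on_input is_rule) ruleF)
    (st (f, b, c, r) (size u).+1 (rev (log_cells D)) [::] C)
    (size rs * (n * (K + 40) + 2))
    (st (f, b', c', r') (size w).+1 (rev (log_cells (round rs D))) [::] C).
Proof.
elim: rs u b c r D => [|x rs IH] u b c r D /= wE Dm.
  have -> : size w = size u by rewrite wE cats0.
  exists b, c, r; apply: exec_le_whileN => //.
  by rewrite /look /= wE input_at_cat.
have ye := rule_or_end_rules rs.
(* The log only grows, so the bound on the log at the end of the round also holds for the present
   one. *)
have Dm1 : size (log_cells D) <= m.
  apply: leq_trans Dm; have: size (log_cells D) <= size (log_cells (rule_step D x)).
    by rewrite size_log_step leq_addr.
  elim: (rs) (rule_step D x) => //= y rs' IH' D1 h; apply: IH'.
  by rewrite size_log_step; apply: leq_trans h (leq_addr _ _).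
have [b1 [c1 [r1 e1]]] := rule_exec b c r wE ye Dm1.
have [||b2 [c2 [r2 e2]]] := IH (u ++ encode_rule x) b1 c1 r1 (rule_step D x) => //.
  by rewrite -catA.
exists b2, c2, r2; apply: (exec_le_whileT _ e1 e2).
  by rewrite /look /= wE input_at_cat.
have : size (encode_rule x) <= n.
  have -> : n = size u + size (encode_rule x) +
      size (flatten (map (@encode_rule _) rs)).
    by rewrite -addnA -!size_cat; congr size.
  by rewrite -addnA addnCA leq_addr.
by rewrite mulSn; move: K => K' h; nia.
Qed.

Variable G : bcfg Sigma.
Hypothesis wG : w = encode_cfg G.
Let rs := cfg_rules G.

Lemma round_exec b c r D p : p <= n.+1 ->
  size (log_cells (round rs D)) <= m -> exists b' c' r',
  E roundF (st (f, b, c, r) p (rev (log_cells D)) [::] C)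
    (n.+1 * n.+1 * (K + 60))
    (st (f, b', c', r') n.+1 (rev (log_cells (round rs D))) [::] C).
Proof.
move=> pn Dm; have [b' [c' [r' e]]] := round_body_exec b c r wG Dm.
exists b', c', r'.
apply: (exec_le_seqs (rewind _ _ _ _ pn)).
  apply: (exec_le_seqs (n := 1) (s1 := st (f, b, c, r) 1 (rev (log_cells D)) [::] C)).
  - by apply: exec_le_do => //; rewrite /look /= /st; congr Store; lia.
  - have := scan_right (f, b, c, r) (b := fun x => ~~ is_rule x) (u := [::])
      (rev (log_cells D)) [::] C wG.
    move=> e1; apply: exec_le_seqs; first apply: e1.
    + by rewrite /= all_map; apply/allP.
    + by case: (cfg_rules G) => //= ? ?; rewrite negbK.
    + by apply: (exec_le_seqs e); [apply: exec_le_nil | apply: leqnn].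
    + exact: leqnn.
  - exact: leqnn.
have hN : size (encode_nonterm Sigma (cfg_start G)) <= n.
  by rewrite /n wG size_cat leq_addr.
have hr : size rs <= n.
  rewrite /n wG size_cat; apply: leq_trans (leq_addl _ _); rewrite /rs.
  elim: (cfg_rules G) => //= x rs' IH; rewrite size_cat /=; lia.
have h : size (cfg_rules G) * (n * (K + 40) + 2) <= n * (n * (K + 40) + 2).
  by rewrite leq_mul2r hr orbT.
apply: leq_ltn_trans (_ : 6 * n + n * (n * (K + 40) + 2) + 10 < _).
  move: (size (cfg_rules G) * _) (n * (n * _ + _)) h (size (encode_nonterm _ _)) hN.
  by move=> T U h N hN; lia.
by move: K => K'; nia.
Qed.

End Rules.

(** The entry of a rule is shorter than the encoding of that rule, which contains the same name with
    two markers. *)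
Lemma size_log_round (rs : seq (seq bool * seq symb)) (D : log) :
  size (log_cells (round rs D)) <=
  size (log_cells D) + size (flatten (map (@encode_rule _) rs)).
Proof.
elim: rs D => [|x rs IH] D; first by rewrite addn0.
have -> : size (flatten (map (@encode_rule _) (x :: rs))) =
    size (encode_rule x) + size (flatten (map (@encode_rule _) rs)).
  by rewrite -size_cat.
apply: leq_trans (IH _) _; rewrite size_log_step -addnA leq_add2l leq_add2r.
by rewrite /= size_cat size_map; lia.
Qed.

Let R m := n.+1 * n.+1 * (m.+1 * (6 * n + 50) + 60).

(** The hypothesis on [m] reserves [n] cells for each remaining round, so that all rounds obey the
    same cost bound [R m]. *)
Lemma saturate_exec G f b c r D C p m : w = encode_cfg G -> p <= n.+1 ->
  size (log_cells D) + size C * n <= m -> exists b' c' r' p', p' <= n.+1 /\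
  E (whileF (nonempty 2) (seqsF [:: doF tickA; roundF]))
    (st (f, b, c, r) p (rev (log_cells D)) [::] C) (size C * (R m + 10))
    (st (f, b', c', r') p'
       (rev (log_cells (iter (size C) (round (cfg_rules G)) D))) [::] [::]).
Proof.
move=> wG; elim: C D b c r p => [|x C IH] D b c r p pn Dm.
  by exists b, c, r, p; split=> //; apply: exec_le_whileN.
have hf : size (flatten (map (@encode_rule _) (cfg_rules G))) <= n.
  by rewrite /n wG size_cat leq_addl.
have Dn := size_log_round (cfg_rules G) D.
have szn : size w = n by [].
have Dm1 : size (log_cells (round (cfg_rules G) D)) <= m.
  by apply: leq_trans Dn _; move: Dm; rewrite /= mulSn; lia.
have [b1 [c1 [r1 e1]]] := round_exec f C wG b c r pn Dm1.
have [||b2 [c2 [r2 [p2 [hp2 e2]]]]] := IH (round (cfg_rules G) D) b1 c1 r1 n.+1.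
- by [].
- by move: Dm Dn; rewrite /= mulSn; lia.
exists b2, c2, r2, p2; split=> //; rewrite [size (x :: C)]/= iterSr.
apply: (exec_le_whileT (n := R m + 5) _ _ e2); [by [] | | by move: (R m) => X; rewrite /= mulSn; lia].
apply: (exec_le_seqs (n := 1) (s1 := st (f, b, c, r) p (rev (log_cells D)) [::] C)).
- by apply: exec_le_do => //; rewrite /look /= /st; congr Store; lia.
- by apply: (exec_le_seqs e1); [apply: exec_le_nil | apply: leqnn].
- by rewrite /R; lia.
Qed.

Lemma main_exec G f b c r p C : w = encode_cfg G -> p <= n.+1 ->
  exists b' c' p' D1,
  E mainF (st (f, b, c, r) p [::] [::] C)
    (size C * (R (size C * n) + 10) + (size C * n).+1 * (3 * n + 30) + 3 * n + 20)
    (st (f, b', c', lookup (saturate M G (size C)) (cfg_start G)) p' D1 [::] [::]).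
Proof.
move=> wG pn; set m := size C * n.
have szn : size w = n by [].
have [|b1 [c1 [r1 [p1 [hp1 e1]]]]] := @saturate_exec G f b c r [::] C p m wG pn.
  by [].
set D := iter _ _ _ in e1.
have Dm : size (log_cells D) <= m.
  rewrite /D /m; elim: (size C) => //= t IH; apply: leq_trans (size_log_round _ _) _.
  rewrite mulSn addnC; apply: leq_add IH.
  by rewrite /n wG size_cat leq_addl.
exists true, c1, 1, (rev (log_cells D)).
apply: (exec_le_seqs e1).
  apply: (exec_le_seqs (rewind _ _ _ _ hp1)).
    apply: (exec_le_seqs (n := 1) (s1 := st (f, b1, c1, r1) 1 (rev (log_cells D)) [::] [::])).
    + by apply: exec_le_do => //; rewrite /look /= /st; congr Store; lia.
    + apply: exec_le_seqs.
      * apply: (@lookup_exec [::] (cfg_start G)); first exact: wG.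
        by case: (cfg_rules G).
      * exact: exec_le_nil.
      * exact: leqnn.
    + exact: leqnn.
  exact: leqnn.
have : (size (log_cells D)).+1 * (3 * n + 30) <= m.+1 * (3 * n + 30).
  by rewrite leq_mul2r ltnS Dm orbT.
rewrite addn0; move: (_.+1 * _) (m.+1 * _) (size C * _) => T U W h; lia.
Qed.

Lemma read_exec k v :
  E (readF k) (st v 0 [::] [::] [::]) (n * (2 * k + 6) + 5)
    (st (foldl format_step v.1.1.1 w, v.1.1.2, v.1.2, v.2) n.+1 [::] [::]
       (nseq (n * k) (inl false))).
Proof.
case: v => [[[f b] c] r] /=; have szn : size w = n by [].
apply: (exec_le_seqs (n := 1) (s1 := st (f, b, c, r) 1 [::] [::] [::])).
- by apply: exec_le_do => //; rewrite /look /= /st; congr Store; lia.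
- apply: exec_le_seqs; [ | exact: exec_le_nil | exact: leqnn].
  suff loop u y C f' : w = u ++ y ->
    E (whileF (on_input predT) (seqsF (rcons (nseq k (doF tallyA)) (doF formatA))))
      (st (f', b, c, r) (size u).+1 [::] [::] C) (size y * (2 * k + 6))
      (st (foldl format_step f' y, b, c, r) n.+1 [::] [::]
         (nseq (size y * k) (inl false) ++ C)).
    by have := loop [::] w [::] f erefl; rewrite cats0; apply.
  elim: y u C f' => [|a y IH] u C f' wE /=.
    have -> : n = size u by rewrite /n wE cats0.
    by apply: exec_le_whileN => //; rewrite /look /= wE input_at_cat.
  have sz : size w = (size u + size y).+1 by rewrite wE size_cat /=; lia.
  apply: (exec_le_whileT (n := 2 * k + 3)
    (s1 := st (format_step f' a, b, c, r) (size (rcons u a)).+1 [::] [::]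
             (nseq k (inl false) ++ C))).
  + by rewrite /look /= wE input_at_cat.
  + clear IH; elim: k C => [|k IHk] C /=.
      apply: (exec_le_seqs (n := 1)); [ | exact: exec_le_nil | by []].
      apply: exec_le_do => //; rewrite /look wE input_at_cat -wE /= /st; congr Store.
      by rewrite size_rcons; lia.
    apply: (exec_le_seqs (n := 1)
      (s1 := st (f', b, c, r) (size u).+1 [::] [::] (inl false :: C))).
    * by apply: exec_le_do => //; rewrite /look /= /st; congr Store; lia.
    * by have := IHk (inl false :: C); rewrite -[inl false :: C]/(nseq 1 _ ++ C) catA -nseqD addn1; apply.
    * by lia.
  + have := IH (rcons u a) (nseq k (inl false) ++ C) (format_step f' a).
    rewrite cat_rcons catA -nseqD mulSn [size y * k + k]addnC; apply.
    exact: wE.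
  + by lia.
- by lia.
Qed.

End Execution.

(** What a format state asserts about the prefix already read. Inside a name after a rule marker,
    the next bit extends the head of the last rule if its right-hand side is still empty, and
    otherwise the nonterminal at its end; hence the disjunction. *)
Let format_shape (f : format) (x : seq (gsym Sigma)) : Prop :=
  match f with
  | None => True
  | Some (false, None) => x = [::]
  | Some (false, Some true) => exists A, x = encode_nonterm Sigma A
  | Some (false, Some false) => False
  | Some (true, None) => exists G : bcfg Sigma, x = rcons (encode_cfg G) GRule
  | Some (true, Some true) => exists S rs A xs,
      x = encode_cfg (@Cfg _ Sigma S (rcons rs (A, xs))) /\
      (xs = [::] \/ exists xs' B, xs = rcons xs' (inl B))
  | Some (true, Some false) => exists S rs A xs,
      x = encode_cfg (@Cfg _ Sigma S (rcons rs (A, xs)))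
  end.

Let encode_cfg_rcons S rs A xs : encode_cfg (@Cfg _ Sigma S (rcons rs (A, xs))) =
  encode_cfg (Cfg S rs) ++ GRule :: encode_nonterm Sigma A ++
    flatten (map (@encode_symbol Sigma) xs).
Proof. by rewrite /encode_cfg /= map_rcons flatten_rcons -!catA. Qed.

Let encode_cfg_rcons2 S rs A xs X :
  encode_cfg (@Cfg _ Sigma S (rcons rs (A, rcons xs X))) =
  encode_cfg (@Cfg _ Sigma S (rcons rs (A, xs))) ++ encode_symbol X.
Proof. by rewrite !encode_cfg_rcons map_rcons flatten_rcons -!catA /= -!catA. Qed.

Let format_shapeP x :
  format_shape (foldl format_step (Some (false, None)) x) x.
Proof.
elim/last_ind: x => // x a; rewrite foldl_rcons.
case: (foldl _ _ _) => [[[] [[]|]]|] //.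
- case=> S [rs [A [xs [xE hx]]]]; case: a => [b|a||] //=.
  + case: hx xE => [->|[xs' [B ->]]] ->.
      exists S, rs, (rcons A b), [::]; split; last by left.
      rewrite !encode_cfg_rcons rcons_cat !cats0; congr (_ ++ _).
      by rewrite /encode_nonterm map_rcons.
    exists S, rs, A, (rcons xs' (inl (rcons B b))); split; last first.
      by right; exists xs', (rcons B b).
    rewrite !encode_cfg_rcons2 rcons_cat; congr (_ ++ _).
    by rewrite /= /encode_nonterm map_rcons.
  + by exists S, rs, A, (rcons xs (inr a)); rewrite encode_cfg_rcons2 cats1 xE.
  + exists S, rs, A, (rcons xs (inl [::])); split; last first.
      by right; exists xs, [::].
    by rewrite encode_cfg_rcons2 cats1 xE.
  + by exists (Cfg S (rcons rs (A, xs))); rewrite xE.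
- case=> S [rs [A [xs xE]]]; case: a => [b|a||] //=.
  + by exists S, rs, A, (rcons xs (inr a)); rewrite encode_cfg_rcons2 cats1 xE.
  + exists S, rs, A, (rcons xs (inl [::])); split; last first.
      by right; exists xs, [::].
    by rewrite encode_cfg_rcons2 cats1 xE.
  + by exists (Cfg S (rcons rs (A, xs))); rewrite xE.
- case=> [[S rs]] xE; case: a => //=.
  exists S, rs, [::], [::]; split; last by left.
  by rewrite xE encode_cfg_rcons -!cats1 -catA.
- case=> A xE; case: a => [b|a||] //=.
    by exists (rcons A b); rewrite xE /encode_nonterm map_rcons rcons_cons.
  by exists (Cfg A [::]); rewrite /encode_cfg /= cats0 xE.
- by move=> xE; case: a => //=; exists [::]; rewrite xE.
Qed.

Let format_bits (r : bool) A :
  foldl format_step (Some (r, Some true)) (map GBit A) = Some (r, Some true).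
Proof. by case: r; elim: A. Qed.

Lemma format_okP x :
  format_ok (foldl format_step (Some (false, None)) x) <->
  exists G : bcfg Sigma, x = encode_cfg G.
Proof.
split=> [|[[S rs] ->]].
  move: (format_shapeP x); case: (foldl _ _ _) => [[[] [[]|]]|] //=.
  - by case=> S [rs [A [xs [-> _]]]] _; eexists.
  - by case=> S [rs [A [xs ->]]] _; eexists.
  - by case=> A -> _; exists (Cfg A [::]); rewrite /encode_cfg /= cats0.
rewrite /encode_cfg foldl_cat /= format_bits.
suff [r [b ->]] : exists r b, foldl format_step (Some (false, Some true))
    (flatten (map (@encode_rule Sigma) rs)) = Some (r, Some b) by [].
(* The state is generalised: after each complete rule the automaton is in some state
   [Some (r, Some b)], and every such state accepts. *)
elim: rs false true => [|[A xs] rs IH] r b; first by exists r, b.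
have -> : foldl format_step (Some (r, Some b))
    (flatten (map (@encode_rule Sigma) ((A, xs) :: rs))) =
  foldl format_step (Some (true, None)) (encode_nonterm Sigma A ++
    flatten (map (@encode_symbol Sigma) xs) ++ flatten (map (@encode_rule _) rs)).
  by case: r b => [] []; rewrite /= -catA.
rewrite /= !foldl_cat format_bits.
suff fs b1 : exists b2, foldl format_step (Some (true, Some b1))
    (flatten (map (@encode_symbol Sigma) xs)) = Some (true, Some b2).
  by have [b2 ->] := fs true; apply: IH.
elim: xs b1 => [|X xs IHx] b1 /=; first by exists b1.
rewrite foldl_cat; case: X => [B|a] /=.
  by case: b1; rewrite format_bits; apply: IHx.
by case: b1; apply: IHx.
Qed.

Lemma cfg_ip_in_P (L : lang Sigma) :
  (forall w, L w <-> dfa_accepts M w) -> in_P (cfg_ip L).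
Proof.
move=> LM; pose v0 : vars := (Some (false, None), false, set0, set0).
set k := #|{: Q * Q}|.
pose R n m := n.+1 * n.+1 * (m.+1 * (6 * n + 50) + 60).
(* The costs of reading and of the main program, the latter with [n * k] rounds and hence a log of
   at most [n * k * n] cells. The factor 2 below comes from compilation. *)
pose t n := n * (2 * k + 6) + 5 + (n * k * (R n (n * k * n) + 10) +
  (n * k * n).+1 * (3 * n + 30) + 3 * n + 20) + 10.
have [a [d hd]] : exists a d, forall n, 2 * t n <= a * n ^ d + a.
  apply: poly_boundedE; rewrite /t /R.
  have pS f : poly_bounded f -> poly_bounded (fun n => (f n).+1).
    move=> pf; have := poly_bounded_add pf (poly_bounded_const 1).
    by move=> [b [e h]]; exists b, e => n; rewrite -addn1.
  by repeat first [ apply: poly_bounded_add | apply: poly_bounded_mul |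
    apply: poly_bounded_const | apply: poly_bounded_id | apply: pS ].
exists (compile 3 deciderF v0 decider_acc), a, d => w.
have e0 := read_exec w k v0.
have run s' : exec_le 3 w (fun _ => True) deciderF
    (Store v0 0 (nseq 3 [::]) [::]) (t (size w)) s' ->
  exists n (c : config (compile 3 deciderF v0 decider_acc)),
    [/\ n <= a * size w ^ d + a, halts_with w n c &
      tm_accept (c_state c) = decider_acc (sv s')].
  case=> n hn /compile_exec - /(_ decider_acc) [[c [hc _ accE]] _].
  exists (2 * n), c; split=> //.
  by apply: leq_trans (hd _); rewrite leq_mul2l.
have runG G : w = encode_cfg G ->
  exists n (c : config (compile 3 deciderF v0 decider_acc)),
    [/\ n <= a * size w ^ d + a, halts_with w n c &
      tm_accept (c_state c) <-> exists u, cfg_lang G u /\ dfa_accepts M u].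
  move=> wG; have fw : format_ok (foldl format_step (Some (false, None)) w).
    by apply/format_okP; exists G.
  have [b [c [p [D1 e1]]]] := main_exec (foldl format_step (Some (false, None)) w)
    false set0 set0 (nseq (size w * k) (inl false)) wG (leqnn _).
  have [|n [cf [hn hc accE]]] := run (st (foldl format_step (Some (false, None)) w,
      b, c, lookup (saturate M G (size w * k)) (cfg_start G)) p D1 [::] [::]).
    apply: exec_le_seqs; first exact: e0.
    + apply: exec_le_seqs; [|exact: exec_le_nil|exact: leqnn].
      rewrite !size_nseq in e1.
      by apply: (exec_le_ifT _ e1); [rewrite /look /= fw | exact: leqnn].
    + rewrite /t /R; move: (size w * (2 * k + 6) + 5) (_ + 3 * size w + 20) => X Y.
      by lia.
  exists n, cf; split=> //; rewrite accE /decider_acc /= fw /=.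
  (* A rule takes at least one letter, so there are at most [size w] rules and the tallies
     suffice. *)
  apply: saturate_correct; rewrite leq_mul2r; apply/orP; right.
  rewrite wG size_cat; apply: leq_trans (leq_addl _ _).
  by elim: (cfg_rules G) => //= x rs' IH; rewrite size_cat /=; lia.
case: (boolP (format_ok (foldl format_step (Some (false, None)) w))) => fw.
- have /format_okP [G wG] := fw; have [n [c [hn hc accE]]] := runG G wG.
  exists n, c; split=> //; split=> [[G' [wG' [u [Gu Lu]]]]|/accE [u [Gu Lu]]].
    (* The witness given by [cfg_ip] has the same code as the grammar that the machine processed. *)
    have GE : G' = G by apply: encode_cfg_inj; rewrite -wG'.
    apply/accE; rewrite -GE.
    by exists u; split=> //; apply/LM.
  by exists G; split=> //; exists u; split=> //; apply/LM.
- have [|n [c [hn hc accE]]] := run (st (foldl format_step (Some (false, None)) w,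
      false, set0, set0) (size w).+1 [::] [::] (nseq (size w * k) (inl false))).
    apply: exec_le_seqs; first exact: e0.
    + apply: exec_le_seqs; [|exact: exec_le_nil|exact: leqnn].
      apply: (exec_le_ifF (n := 0) (t := 1)) => //; first by rewrite /look /= (negbTE fw).
      exact: exec_le_nil.
    + by rewrite /t; move: (size w * (2 * k + 6) + 5) (_ + 3 * size w + 20) => X Y; lia.
  exists n, c; split=> //; rewrite accE /decider_acc /= (negbTE fw); split=> //.
  by case=> G [wG _]; case/negP: fw; apply/format_okP; exists G.
Qed.

End Decider.

(** * Grammars that describe a computation *)

(** Undoing a derivation step preserves the property that all nonterminals of the sentential form
    satisfy [V], and a terminal word has it trivially. *)
Lemma derives_sound (N Sigma : eqType) (G : cfg N Sigma) (V : N -> Prop) A w :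
  (forall B rhs, (B, rhs) \in cfg_rules G ->
     (forall C, inl C \in rhs -> V C) -> V B) ->
  derives G [:: inl A] (map inr w) -> V A.
Proof.
move=> sound d.
have : forall C, inl C \in map (@inr N Sigma) w -> V C by move=> C /mapP [].
have : (inl A : N + Sigma) \in [:: inl A] by rewrite mem_head.
move: {1 3}A; elim: d => [|u v _ IH [l [r [C [rhs [Cr uE vE]]]]]] B.
  by move=> Bu h; apply: h.
move=> BA vV; apply: IH BA _ => D; rewrite uE mem_cat inE.
case/or3P => [Dl|/eqP [->]|Dr].
- by apply: vV; rewrite vE mem_cat Dl.
- apply: sound Cr _ => E Er; apply: vV.
  by rewrite vE !mem_cat Er orbT.
- by apply: vV; rewrite vE !mem_cat Dr !orbT.
Qed.

(** Lowest digit first and cut to [m] digits: a carry runs along the list, and [2 ^ m] wraps around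
    to 0. *)
Fixpoint bin (m a : nat) : seq bool :=
  if m is m'.+1 then odd a :: bin m' a./2 else [::].

Lemma size_bin m a : size (bin m a) = m.
Proof. by elim: m a => //= m IH a; rewrite IH. Qed.

Lemma bin_inj m a b : a < 2 ^ m -> b < 2 ^ m -> bin m a = bin m b -> a = b.
Proof.
elim: m a b => [|m IH] a b; first by case: a; case: b.
rewrite expnS => ha hb [eo eb].
rewrite -(odd_double_half a) -(odd_double_half b) eo.
by congr (_ + _.*2); apply: IH eb; lia.
Qed.

(** The kinds of facts; [fact] below gives their meaning. [TScan] asserts the symbol under a head at
    every position, so that a [TStep] follows from facts about one position only. *)
Inductive ftag (J U Q F : Type) :=
| TStart
| TAcc
| TZero
| TState of Q
| TStep of Q & F
| THead of J
| TLeft of J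
| TRight of J
| TCell of J & U
| TScan of J & U.
Arguments TStart {J U Q F}.
Arguments TAcc {J U Q F}.
Arguments TZero {J U Q F}.
Arguments TState {J U Q F} _.
Arguments TStep {J U Q F} _ _.
Arguments THead {J U Q F} _.
Arguments TLeft {J U Q F} _.
Arguments TRight {J U Q F} _.
Arguments TCell {J U Q F} _ _.
Arguments TScan {J U Q F} _ _.

Section FactTagCode.

Variables J U Q F : Type.

Definition ftag_code (x : ftag J U Q F) :
    option bool + (Q + Q * F) + (option bool * J + bool * (J * U)) :=
  match x with
  | TStart => inl (inl None)
  | TAcc => inl (inl (Some false))
  | TZero => inl (inl (Some true))
  | TState q => inl (inr (inl q))
  | TStep q f => inl (inr (inr (q, f)))
  | THead j => inr (inl (None, j))
  | TLeft j => inr (inl (Some false, j))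
  | TRight j => inr (inl (Some true, j))
  | TCell j u => inr (inr (false, (j, u)))
  | TScan j u => inr (inr (true, (j, u)))
  end.

Definition ftag_decode
    (x : option bool + (Q + Q * F) + (option bool * J + bool * (J * U))) :
    ftag J U Q F :=
  match x with
  | inl (inl None) => TStart
  | inl (inl (Some false)) => TAcc
  | inl (inl (Some true)) => TZero
  | inl (inr (inl q)) => TState q
  | inl (inr (inr (q, f))) => TStep q f
  | inr (inl (None, j)) => THead j
  | inr (inl (Some false, j)) => TLeft j
  | inr (inl (Some true, j)) => TRight j
  | inr (inr (false, (j, u))) => TCell j u
  | inr (inr (true, (j, u))) => TScan j u
  end.

Lemma ftag_codeK : cancel ftag_code ftag_decode.
Proof. by case. Qed.

End FactTagCode.

HB.instance Definition _ (J U Q F : eqType) :=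
  Equality.copy (ftag J U Q F) (can_type (@ftag_codeK J U Q F)).
HB.instance Definition _ (J U Q F : choiceType) :=
  Choice.copy (ftag J U Q F) (can_type (@ftag_codeK J U Q F)).
HB.instance Definition _ (J U Q F : countType) :=
  Countable.copy (ftag J U Q F) (can_type (@ftag_codeK J U Q F)).
HB.instance Definition _ (J U Q F : finType) :=
  Finite.copy (ftag J U Q F) (can_type (@ftag_codeK J U Q F)).

(* An atom [(t, d, e)] stands, at time [T] and position [p], for the fact [t]
   at time [T + d] and position [p + e]. *)
Definition schema (T Sigma : Type) :=
  ((T * bool * bool) * seq (T * bool * bool + Sigma))%type.

(** * Grammars whose nonterminals name facts *)

Section Grammar.

Variables (T : finType) (Sigma : finType) (m : nat).

(** A one-hot code: all codes have the same length, so the fields of a name can be separated. *)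
Definition fact_code (t : T) : seq bool := [seq t == u | u <- enum T].

Lemma fact_code_inj : injective fact_code.
Proof.
move=> t t' /eq_in_map /(_ t); rewrite eqxx mem_enum => /(_ isT) /esym.
by move/eqP.
Qed.

(** Schemas are instantiated below [2 ^ m], but their atoms may be shifted by one and reach [2 ^ m]
    itself; hence [m.+1] digits. *)
Definition fact_name (t : T) (i p : nat) : seq bool :=
  fact_code t ++ bin m.+1 i ++ bin m.+1 p.

Lemma fact_name_inj t i p t' i' p' :
  i <= 2 ^ m -> p <= 2 ^ m -> i' <= 2 ^ m -> p' <= 2 ^ m ->
  fact_name t i p = fact_name t' i' p' -> [/\ t = t', i = i' & p = p'].
Proof.
have lt a : a <= 2 ^ m -> a < 2 ^ m.+1.
  by move=> h; apply: leq_ltn_trans h _; rewrite ltn_exp2l.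
move=> /lt hi /lt hp /lt hi' /lt hp' /eqP.
rewrite eqseq_cat ?size_map // => /andP [/eqP /fact_code_inj ->].
rewrite eqseq_cat ?size_bin // => /andP [/eqP /bin_inj -> // /eqP /bin_inj -> //].
Qed.

Definition inst_atom (i p : nat) (x : T * bool * bool) : seq bool :=
  fact_name x.1.1 (i + x.1.2) (p + x.2).

Definition inst_symbol (i p : nat) (y : T * bool * bool + Sigma) :
    seq bool + Sigma :=
  match y with inl x => inl (inst_atom i p x) | inr a => inr a end.

Definition inst (i p : nat) (r : schema T Sigma) :
    seq bool * seq (seq bool + Sigma) :=
  (inst_atom i p r.1, map (inst_symbol i p) r.2).

Definition fact_cfg (start : T) (init : seq (schema T Sigma))
    (row : nat -> seq (schema T Sigma)) (rules : seq (schema T Sigma)) :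
    bcfg Sigma :=
  Cfg (fact_name start 0 0)
    (map (inst 0 0) init ++
     flatten [seq map (inst 0 p) (row p) | p <- iota 0 (2 ^ m)] ++
     flatten [seq flatten [seq map (inst i p) rules | p <- iota 0 (2 ^ m)]
             | i <- iota 0 (2 ^ m)]).

Section Semantics.

Variables (start : T) (init : seq (schema T Sigma))
  (row : nat -> seq (schema T Sigma)) (rules : seq (schema T Sigma)).
Let G := fact_cfg start init row rules.

Lemma mem_init r : r \in init -> inst 0 0 r \in cfg_rules G.
Proof. by move=> hr; rewrite mem_cat map_f. Qed.

Lemma mem_row r p : p < 2 ^ m -> r \in row p -> inst 0 p r \in cfg_rules G.
Proof.
move=> hp hr; rewrite !mem_cat; apply/orP; right; apply/orP; left.
apply/flattenP; exists (map (inst 0 p) (row p)); last exact: map_f.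
by apply: map_f; rewrite mem_iota.
Qed.

Lemma mem_rules r i p : i < 2 ^ m -> p < 2 ^ m -> r \in rules ->
  inst i p r \in cfg_rules G.
Proof.
move=> hi hp hr; rewrite !mem_cat; apply/orP; right; apply/orP; right.
apply/flattenP.
exists (flatten [seq map (inst i p) rules | p <- iota 0 (2 ^ m)]).
  apply/mapP; exists i => //; by rewrite mem_iota.
apply/flattenP; exists (map (inst i p) rules); last exact: map_f.
by apply: map_f; rewrite mem_iota.
Qed.

Definition valid (sem : T -> nat -> nat -> Prop) (i p : nat) (r : schema T Sigma) :=
  (forall x, inl x \in r.2 -> sem x.1.1 (i + x.1.2) (p + x.2)) ->
  sem r.1.1.1 (i + r.1.1.2) (p + r.1.2).

(** Names determine their facts within the range used, so a semantics of facts becomes a property of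
    nonterminals and [derives_sound] applies. *)
Lemma fact_sound (sem : T -> nat -> nat -> Prop) w :
  (forall r, r \in init -> valid sem 0 0 r) ->
  (forall p r, r \in row p -> valid sem 0 p r) ->
  (forall i p r, r \in rules -> valid sem i p r) ->
  derives G [:: inl (cfg_start G)] (map inr w) -> sem start 0 0.
Proof.
move=> hinit hrow hrules.
pose V A := exists t i p,
  [/\ A = fact_name t i p, i <= 2 ^ m, p <= 2 ^ m & sem t i p].
have vV i p r : i < 2 ^ m -> p < 2 ^ m -> valid sem i p r ->
    (forall C, inl C \in (inst i p r).2 -> V C) -> V (inst i p r).1.
  move=> hi hp vr hV.
  have le a (d : bool) : a < 2 ^ m -> a + d <= 2 ^ m by case: d => /=; lia.
  exists r.1.1.1, (i + r.1.1.2), (p + r.1.2); split=> //; try exact: le.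
  apply: vr => x xr; have [|t [i' [p' [E hi' hp' st]]]] := hV (inst_atom i p x).
    by apply/mapP; exists (inl x).
  by have [||-> -> ->] := fact_name_inj _ _ hi' hp' E; [exact: le | exact: le |].
have p0 : 0 < 2 ^ m by rewrite expn_gt0.
move=> d; have : V (fact_name start 0 0).
  apply: derives_sound d => B rhs; rewrite !mem_cat => /or3P [].
  - by case/mapP => r hr -[-> ->]; apply: vV => //; apply: hinit.
  - case/flattenP => s /mapP [p]; rewrite mem_iota => hp -> /mapP [r hr [-> ->]].
    by apply: vV => //; apply: hrow.
  - case/flattenP => s /mapP [i]; rewrite mem_iota => hi -> /flattenP [s'].
    case/mapP => p; rewrite mem_iota => hp -> /mapP [r hr [-> ->]].
    by apply: vV => //; apply: hrules.
by move=> [t [i [p [E hi hp st]]]]; have [//|//|? ? ?] := fact_name_inj _ _ hi hp E; subst t i p.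
Qed.

Definition derivable t i p := derives G [:: inl (fact_name t i p)] [::].

Lemma derivable_inst i p (r : schema T Sigma) : inst i p r \in cfg_rules G ->
  (forall y, y \in r.2 -> exists2 x, y = inl x &
     derivable x.1.1 (i + x.1.2) (p + x.2)) ->
  derivable r.1.1.1 (i + r.1.1.2) (p + r.1.2).
Proof.
move=> hr hb; apply: derives_rule hr _.
elim: (r.2) hb => [_|y s IH hb] /=; first exact: derives_refl.
have [x -> dx] := hb y (mem_head _ _).
rewrite -cat1s -[[::]]cat0s; apply: derives_cat => //.
by apply: IH => z zs; apply: hb; rewrite inE zs orbT.
Qed.

End Semantics.

End Grammar.

(** * Horn clauses for a multi-tape machine *)

Section Computation.

Variables (J U Q : finType) (Sigma : finType) (m : nat).
Notation F := {ffun J -> U}.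
Variables (q0 : Q) (delta : Q -> F -> option (Q * {ffun J -> U * move})).
Variables (acc : pred Q) (word : seq Sigma).
Notation T := (ftag J U Q F).
Notation schema := (schema T Sigma).

Let now (t : T) : T * bool * bool := (t, false, false).
Let up (t : T) : T * bool * bool := (t, true, false).
Let right (t : T) : T * bool * bool := (t, false, true).
Let upright (t : T) : T * bool * bool := (t, true, true).

Let horn (x : T * bool * bool) (xs : seq (T * bool * bool)) : schema :=
  (x, map inl xs).

Definition init_schemas : seq schema :=
  (now TStart, inl (now TAcc) :: map inr word) ::
  horn (now TZero) [::] :: [seq horn (now (THead j)) [::] | j <- enum J].

Definition row_schemas (c : J -> U) : seq schema :=
  horn (now (TState q0)) [::] :: [seq horn (now (TCell j (c j))) [::] | j <- enum J].

(** Acceptance travels back in time, to reach the atom of the start rule at time 0; the marker of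
    position 0 travels forward. *)
Definition global_schemas : seq schema :=
  [:: horn (now TAcc) [:: up TAcc]; horn (up TZero) [:: now TZero]].

Definition tape_schemas (j : J) : seq schema :=
  [:: horn (now (TLeft j)) [:: right (THead j)];
      horn (now (TLeft j)) [:: right (TLeft j)];
      horn (right (TRight j)) [:: now (THead j)];
      horn (right (TRight j)) [:: now (TRight j)]].

(** The first three clauses introduce the scanned symbol and spread it in both directions. The last
    two are frame rules: a cell beside the head keeps its content. *)
Definition cell_schemas (x : J * U) : seq schema :=
  [:: horn (now (TScan x.1 x.2)) [:: now (THead x.1); now (TCell x.1 x.2)];
      horn (now (TScan x.1 x.2)) [:: right (TScan x.1 x.2)];
      horn (right (TScan x.1 x.2)) [:: now (TScan x.1 x.2)];
      horn (up (TCell x.1 x.2)) [:: now (TCell x.1 x.2); now (TLeft x.1)];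
      horn (up (TCell x.1 x.2)) [:: now (TCell x.1 x.2); now (TRight x.1)]].

(** A left move needs two clauses, since the head stays at position 0. As an instance cannot test
    its own position, the second clause has the premise [TZero]. *)
Definition move_schemas (s : T) (j : J) (a : U * move) : seq schema :=
  horn (up (TCell j a.1)) [:: now s; now (THead j)] ::
  match a.2 with
  | MLeft => [:: horn (up (THead j)) [:: now s; right (THead j)];
                 horn (up (THead j)) [:: now s; now (THead j); now TZero]]
  | MStay => [:: horn (up (THead j)) [:: now s; now (THead j)]]
  | MRight => [:: horn (upright (THead j)) [:: now s; now (THead j)]]
  end.

Definition step_schemas (x : Q * F) : seq schema :=
  let s := TStep x.1 x.2 in
  horn (now s) (now (TState x.1) :: [seq now (TScan j (x.2 j)) | j <- enum J]) ::
  match delta x.1 x.2 with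
  | None => if acc x.1 then [:: horn (now TAcc) [:: now s]] else [::]
  | Some (q, a) => horn (up (TState q)) [:: now s] ::
      flatten [seq move_schemas s j (a j) | j <- enum J]
  end.

Definition machine_schemas : seq schema :=
  global_schemas ++ flatten (map tape_schemas (enum J)) ++
  flatten (map cell_schemas (enum {: J * U})) ++
  flatten (map step_schemas (enum {: Q * F})).

Variables (qs : nat -> Q) (hd : nat -> J -> nat) (cl : nat -> J -> nat -> U).

Let sc t : F := [ffun j => cl t j (hd t j)].

Hypothesis qs0 : qs 0 = q0.
Hypothesis hd0 : forall j, hd 0 j = 0.
Hypothesis step_some : forall t q a, delta (qs t) (sc t) = Some (q, a) ->
  [/\ qs t.+1 = q, forall j, hd t.+1 j = shift (a j).2 (hd t j) &
    forall j p, cl t.+1 j p = if p == hd t j then (a j).1 else cl t j p].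
(** The trajectory stands still after halting: clauses are instantiated at all times below [2 ^ m],
    so facts need a meaning beyond the halting time. *)
Hypothesis step_none : forall t, delta (qs t) (sc t) = None ->
  [/\ qs t.+1 = qs t, forall j, hd t.+1 j = hd t j &
    forall j p, cl t.+1 j p = cl t j p].

Definition accepts := exists2 t, delta (qs t) (sc t) = None & acc (qs t).

(** The intended model, in which all clauses hold. Acceptance is independent of time and position
    there, since [TAcc] is carried back through time. *)
Definition fact (x : T) (t p : nat) : Prop :=
  match x with
  | TStart => accepts
  | TAcc => accepts
  | TZero => p = 0
  | TState q => qs t = q
  | TStep q f => qs t = q /\ sc t = f
  | THead j => hd t j = p
  | TLeft j => p < hd t j
  | TRight j => hd t j < p
  | TCell j u => cl t j p = u
  | TScan j u => cl t j (hd t j) = u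
  end.

Let persists t j p : p != hd t j -> cl t.+1 j p = cl t j p.
Proof.
move=> hp; case E: (delta (qs t) (sc t)) => [[q a]|]; last first.
  by have [_ _ ->] := step_none E.
by have [_ _ ->] := step_some E; rewrite (negbTE hp).
Qed.

Let valid_horn t p (x : T * bool * bool) (xs : seq (T * bool * bool)) :
  (foldr (fun y : T * bool * bool => and (fact y.1.1 (t + y.1.2) (p + y.2))) True xs ->
    fact x.1.1 (t + x.1.2) (p + x.2)) ->
  valid fact t p (horn x xs).
Proof.
move=> h hb; apply: h.
have: forall y, y \in xs -> fact y.1.1 (t + y.1.2) (p + y.2).
  by move=> y hy; apply: hb; apply: map_f.
elim: xs {hb} => //= y xs IH hb; split; first exact: hb (mem_head _ _).
by apply: IH => z hz; apply: hb; rewrite inE hz orbT.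
Qed.

Lemma init_valid r : r \in init_schemas -> valid fact 0 0 r.
Proof.
rewrite !inE => /or3P [/eqP -> h|/eqP ->|/mapP [j _ ->]].
- exact: (h (now TAcc) (mem_head _ _)).
- exact: valid_horn.
- by apply: valid_horn => _ /=; rewrite hd0.
Qed.

Lemma row_valid c p r : (forall j, cl 0 j p = c j) -> r \in row_schemas c ->
  valid fact 0 p r.
Proof.
move=> hc; rewrite !inE => /orP [/eqP ->|/mapP [j _ ->]]; apply: valid_horn => _ //=.
by rewrite !addn0 hc.
Qed.

Lemma machine_valid t p r : r \in machine_schemas -> valid fact t p r.
Proof.
rewrite !mem_cat => /or4P [].
- by rewrite !inE => /orP [] /eqP ->; apply: valid_horn => -[].
- case/flattenP=> s /mapP [j _ ->]; rewrite !inE.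
  by case/or4P=> /eqP ->; apply: valid_horn => -[] /=; lia.
- case/flattenP=> s /mapP [[j u] _ ->]; rewrite !inE /=.
  case/or4P => [/eqP ->|/eqP ->|/eqP ->|/orP [] /eqP ->]; apply: valid_horn => /=.
  + by rewrite !addn0 => -[<- [<- _]].
  + by case.
  + by case.
  + by rewrite !addn0 addn1 => -[<- [h _]]; apply: persists; lia.
  + by rewrite !addn0 addn1 => -[<- [h _]]; apply: persists; lia.
- case/flattenP=> s /mapP [[q f] _ ->]; rewrite inE => /orP [/eqP ->|].
    move=> /= h; rewrite !addn0; split.
      by have := h _ (mem_head _ _); rewrite /= !addn0.
    apply/ffunP=> j; rewrite ffunE.
    have := h (now (TScan j (f j))); rewrite /= !addn0; apply.
    by rewrite inE; apply/orP; right; apply/map_f/map_f; rewrite mem_enum.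
  have st q' a : delta q f = Some (q', a) -> qs t = q /\ sc t = f ->
    [/\ qs t.+1 = q', forall j, hd t.+1 j = shift (a j).2 (hd t j) &
    forall j p, cl t.+1 j p = if p == hd t j then (a j).1 else cl t j p].
    by move=> E [qE fE]; apply: step_some; rewrite qE fE.
  rewrite /=; case E: (delta q f) => [[q' a]|] /=; last first.
    case: ifP => // qa; rewrite inE => /eqP ->; apply: valid_horn => /=.
    by rewrite !addn0 => -[[qE fE] _]; exists t; rewrite ?qE ?fE.
  rewrite inE => /orP [/eqP ->|].
    by apply: valid_horn => /=; rewrite addn0 addn1 => -[/(st _ _ E) []].
  case/flattenP => s' /mapP [j _ ->]; rewrite inE => /orP [/eqP ->|].
    apply: valid_horn => /=; rewrite !addn0 addn1 => -[/(st _ _ E) [_ _ ->]].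
    by case=> <-; rewrite eqxx.
  case aj: (a j) => [u mv] /=; case: mv aj => aj; rewrite !inE.
  - case/orP => /eqP ->; apply: valid_horn => /=; rewrite !addn0 addn1.
      by rewrite addn1 => -[/(st _ _ E) [_ -> _]]; rewrite aj => -[-> _].
    by case=> /(st _ _ E) [_ -> _]; rewrite aj => -[-> [-> _]].
  - move/eqP=> ->; apply: valid_horn => /=; rewrite !addn0 addn1.
    by case=> /(st _ _ E) [_ -> _]; rewrite aj => -[-> _].
  - move/eqP=> ->; apply: valid_horn => /=; rewrite !addn0 !addn1.
    by case=> /(st _ _ E) [_ -> _]; rewrite aj => -[-> _].
Qed.

Let G := fact_cfg m TStart init_schemas (fun p => row_schemas (cl 0 ^~ p)) machine_schemas.

Let G_mem t p r : t < 2 ^ m -> p < 2 ^ m -> r \in machine_schemas ->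
  inst m t p r \in cfg_rules G.
Proof. exact: mem_rules. Qed.

Notation D x t p :=
  (derives G [:: inl (fact_name m (x : T) t p)] [::]).

Let D_horn t p (x : T * bool * bool) (xs : seq (T * bool * bool)) :
  inst m t p (horn x xs) \in cfg_rules G ->
  (forall y, y \in xs -> D y.1.1 (t + y.1.2) (p + y.2)) ->
  D x.1.1 (t + x.1.2) (p + x.2).
Proof.
move=> hr hb; apply: (derivable_inst hr) => y /mapP [z zs ->].
by exists z => //; apply: hb.
Qed.

Let D_foldr t p (x : T * bool * bool) (xs : seq (T * bool * bool)) :
  t < 2 ^ m -> p < 2 ^ m -> horn x xs \in machine_schemas ->
  foldr (fun y : T * bool * bool => and (D y.1.1 (t + y.1.2) (p + y.2))) True xs ->
  D x.1.1 (t + x.1.2) (p + x.2).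
Proof.
move=> ht hp hr hb; apply: D_horn (G_mem ht hp hr) _.
elim: xs hb {hr} => //= y xs IH [dy dxs] z; rewrite inE => /orP [/eqP -> //|].
exact: IH.
Qed.

Variable n : nat.
Hypothesis nm : n < 2 ^ m.
Hypothesis halt : delta (qs n) (sc n) = None.
Hypothesis not_halt : forall t, t < n -> delta (qs t) (sc t) <> None.

(** The halting configuration is repeated forever, so every halting time shows the state [qs n]. *)
Let acceptsE : accepts <-> acc (qs n).
Proof.
split=> [[t tN ta]|an]; last by exists n.
have [tn|nt] := ltnP t n; first by case: (not_halt tn).
suff h k : qs (n + k) = qs n /\ sc (n + k) = sc n.
  by have := h (t - n); rewrite subnKC // => -[<-].
elim: k => [|k [qk sk]]; first by rewrite addn0.
have [] := @step_none (n + k); first by rewrite qk sk.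
rewrite addnS => -> hh hc; split=> //; rewrite -sk.
by apply/ffunP=> j; rewrite !ffunE hh hc.
Qed.

(** A head moves at most one cell per step, which lets one range [2 ^ m] serve for both times and
    positions. *)
Let hd_le t j : t <= n -> hd t j <= t.
Proof.
elim: t => [|t IH] tn; first by rewrite hd0.
case E: (delta (qs t) (sc t)) => [[q a]|]; last by case: (not_halt tn).
have [_ -> _] := step_some E; have := IH (ltnW tn).
by case: (a j).2 => /=; lia.
Qed.

Let in_global r : r \in global_schemas -> r \in machine_schemas.
Proof. by move=> hr; rewrite mem_cat hr. Qed.

Let in_tape j r : r \in tape_schemas j -> r \in machine_schemas.
Proof.
move=> hr; rewrite !mem_cat; apply/or4P/Or42/flattenP.
by exists (tape_schemas j) => //; apply: map_f; rewrite mem_enum.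
Qed.

Let in_cell x r : r \in cell_schemas x -> r \in machine_schemas.
Proof.
move=> hr; rewrite !mem_cat; apply/or4P/Or43/flattenP.
by exists (cell_schemas x) => //; apply: map_f; rewrite mem_enum.
Qed.

Let in_step x r : r \in step_schemas x -> r \in machine_schemas.
Proof.
move=> hr; rewrite !mem_cat; apply/or4P/Or44/flattenP.
by exists (step_schemas x) => //; apply: map_f; rewrite mem_enum.
Qed.

Let in_move q f q' a j r : delta q f = Some (q', a) ->
  r \in move_schemas (TStep q f) j (a j) -> r \in machine_schemas.
Proof.
move=> E hr; apply: (@in_step (q, f)); rewrite inE /= E inE; apply/or3P/Or33.
apply/flattenP; exists (move_schemas (TStep q f) j (a j)) => //.
by apply: map_f; rewrite mem_enum.
Qed.

(** From the head position [h] the symbol is carried cell by cell, rightwards or leftwards, until it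
    arrives at [p]. *)
Let D_scan (j : J) (u : U) t h p : t < 2 ^ m -> h < 2 ^ m -> p < 2 ^ m ->
  D (THead j) t h -> D (TCell j u) t h -> D (TScan j u) t p.
Proof.
move=> ht hh hp dh dc; have inC := @in_cell (j, u).
have d0 : D (TScan j u) t h.
  have /= := @D_foldr t h (now (TScan j u)) [:: now (THead j); now (TCell j u)] ht hh.
  rewrite !addn0; apply=> //; apply: inC; exact: mem_head.
have [le|/ltnW le] := leqP h p.
  move: hp; rewrite -(subnKC le); elim: (p - h) => [|k IH] hk; first by rewrite addn0.
  have hk' : h + k < 2 ^ m by lia.
  have /= := @D_foldr t (h + k) (right (TScan j u)) [:: now (TScan j u)] ht hk'.
  rewrite !addn0 !addn1 addnS; apply; last by split=> //; apply: IH.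
  by apply: inC; rewrite !inE eqxx ?orbT.
rewrite -(subKn le); elim: (h - p) (leq_subr p h) => [|k IH] hk.
  by rewrite subn0.
have hk' : h - k.+1 < 2 ^ m by lia.
have /= := @D_foldr t (h - k.+1) (now (TScan j u)) [:: right (TScan j u)] ht hk'.
rewrite !addn0 !addn1; apply.
  by apply: inC; rewrite !inE eqxx ?orbT.
by split=> //; rewrite -subSn // subSS; apply: IH; apply: ltnW.
Qed.

Let D_left (j : J) t h p : t < 2 ^ m -> h < 2 ^ m -> p < h ->
  D (THead j) t h -> D (TLeft j) t p.
Proof.
move=> ht hh ph dh; have inT := @in_tape j.
have -> : p = h - (h - p.+1).+1 by lia.
have : h - p.+1 < h by lia.
elim: (h - p.+1) => [|k IH] hk.
  have /= := @D_foldr t (h - 1) (now (TLeft j)) [:: right (THead j)] ht.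
  rewrite !addn0 !addn1; apply; first by lia.
    by apply: inT; rewrite mem_head.
  by split=> //; rewrite -subSn // subSS subn0.
have /= := @D_foldr t (h - k.+2) (now (TLeft j)) [:: right (TLeft j)] ht.
rewrite !addn0 !addn1; apply; first by lia.
  by apply: inT; rewrite !inE eqxx ?orbT.
by split=> //; rewrite -subSn // subSS; apply: IH; lia.
Qed.

Let D_right (j : J) t h p : t < 2 ^ m -> p < 2 ^ m -> h < p ->
  D (THead j) t h -> D (TRight j) t p.
Proof.
move=> ht hp hp' dh; have inT := @in_tape j.
move: hp; have -> : p = h + (p - h.+1).+1 by lia.
elim: (p - h.+1) => [|k IH] hk.
  have /= := @D_foldr t h (right (TRight j)) [:: now (THead j)] ht.
  rewrite !addn0 !addn1; apply=> //; first by lia.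
  by apply: inT; rewrite !inE eqxx ?orbT.
have /= := @D_foldr t (h + k.+1) (right (TRight j)) [:: now (TRight j)] ht.
rewrite !addn0 !addn1 (addnS h k.+1); apply; first by lia.
  by apply: inT; rewrite !inE eqxx ?orbT.
by split=> //; apply: IH; lia.
Qed.

(** The completeness invariant. States and cells are required at all positions in range, because the
    step clauses combine facts at the position of each head and the frame clauses work at every
    cell. *)
Let derived t := [/\ forall p, p < 2 ^ m -> D (TState (qs t)) t p,
  forall j, D (THead j) t (hd t j), D TZero t 0 &
  forall j p, p < 2 ^ m -> D (TCell j (cl t j p)) t p].

Let derived0 : derived 0.
Proof.
have inI r : r \in init_schemas -> inst m 0 0 r \in cfg_rules G by apply: mem_init.
have inR p r : p < 2 ^ m -> r \in row_schemas (cl 0 ^~ p) ->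
  inst m 0 p r \in cfg_rules G by move=> hp hr; apply: mem_row.
split=> [p hp|j||j p hp].
- have /= := @D_horn 0 p (now (TState q0)) [::]; rewrite !addn0 qs0; apply=> //.
  by apply: inR; rewrite // mem_head.
- have /= := @D_horn 0 0 (now (THead j)) [::]; rewrite !addn0 hd0; apply=> //.
  apply: inI; rewrite !inE; apply/or3P/Or33/mapP.
  by exists j; rewrite // mem_enum.
- have /= := @D_horn 0 0 (now TZero) [::]; rewrite !addn0; apply=> //.
  by apply: inI; rewrite !inE eqxx ?orbT.
- have /= := @D_horn 0 p (now (TCell j (cl 0 j p))) [::]; rewrite !addn0; apply=> //.
  apply: inR => //; rewrite inE; apply/orP; right; apply/mapP.
  by exists j; rewrite // mem_enum.
Qed.

Let D_step t p : t <= n -> p < 2 ^ m -> derived t -> D (TStep (qs t) (sc t)) t p.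
Proof.
move=> tn hp [ds dh dz dc]; have ht : t < 2 ^ m by lia.
have /= := @D_horn t p (now (TStep (qs t) (sc t)))
  (now (TState (qs t)) :: [seq now (TScan j (sc t j)) | j <- enum J]).
rewrite !addn0; apply.
  by apply: G_mem => //; apply: (@in_step (qs t, sc t)); rewrite inE eqxx.
move=> y; rewrite inE => /orP [/eqP ->|/mapP [j _ ->]] /=; rewrite !addn0.
  exact: ds.
have hh : hd t j < 2 ^ m by have := hd_le j tn; lia.
by apply: (D_scan ht hh hp (dh j)); rewrite ffunE; apply: dc.
Qed.

Let derivedS t : t < n -> derived t -> derived t.+1.
Proof.
move=> tn dt; have [ds dh dz dc] := dt; have ht : t < 2 ^ m by lia.
have dst p : p < 2 ^ m -> D (TStep (qs t) (sc t)) t p.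
  by move=> hp; apply: D_step => //; apply: ltnW.
have hh j : hd t j < 2 ^ m by have := hd_le j (ltnW tn); lia.
case E: (delta (qs t) (sc t)) => [[q a]|]; last by case: (not_halt tn).
have [qE hE cE] := step_some E.
set s := TStep (qs t) (sc t) in dst.
split=> [p hp|j||j p hp].
- have /= := @D_foldr t p (up (TState q)) [:: now s] ht hp.
  rewrite !addn0 !addn1 qE; apply; last by split=> //; apply: dst.
  by apply: (@in_step (qs t, sc t)); rewrite inE /= E !inE eqxx ?orbT.
- have inM r : r \in move_schemas s j (a j) -> r \in machine_schemas.
    exact: in_move E.
  have hs := dst _ (hh j); rewrite hE; case aj: (a j) inM => [u mv].
  have dhj := dh j; case: mv aj => aj inM /=.
  (* At position 0 the clause with [TZero] keeps the head in place; otherwise the clause is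
     instantiated at the target cell, the head being its right neighbour. *)
  + case: (hd t j) (hh j) dhj hs => [|h] hlt dhj hs.
      have /= := @D_foldr t 0 (up (THead j)) [:: now s; now (THead j); now TZero] ht hlt.
      rewrite !addn0 !addn1; apply=> //; apply: inM.
      by rewrite !inE eqxx ?orbT.
    have hlt' : h < 2 ^ m by apply: ltnW.
    have /= := @D_foldr t h (up (THead j)) [:: now s; right (THead j)] ht hlt'.
    rewrite !addn0 !addn1; apply; last by split; [apply: dst | split].
    by apply: inM; rewrite !inE eqxx ?orbT.
  + have /= := @D_foldr t (hd t j) (up (THead j)) [:: now s; now (THead j)] ht (hh j).
    rewrite !addn0 !addn1; apply=> //; apply: inM.
    by rewrite !inE eqxx ?orbT.
  + have /= := @D_foldr t (hd t j) (upright (THead j)) [:: now s; now (THead j)] ht (hh j).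
    rewrite !addn0 !addn1; apply=> //; apply: inM.
    by rewrite !inE eqxx ?orbT.
- have p0 : 0 < 2 ^ m by rewrite expn_gt0.
  have /= := @D_foldr t 0 (up TZero) [:: now TZero] ht p0.
  by rewrite !addn0 !addn1; apply.
- rewrite cE; case: (ltngtP p (hd t j)) => [lt|lt|->].
  + have /= := @D_foldr t p (up (TCell j (cl t j p)))
      [:: now (TCell j (cl t j p)); now (TLeft j)] ht hp.
    rewrite !addn0 !addn1; apply.
      by apply: (@in_cell (j, cl t j p)); rewrite !inE eqxx ?orbT.
    by split; [apply: dc | split=> //; apply: D_left (dh j)].
  + have /= := @D_foldr t p (up (TCell j (cl t j p)))
      [:: now (TCell j (cl t j p)); now (TRight j)] ht hp.
    rewrite !addn0 !addn1; apply.
      by apply: (@in_cell (j, cl t j p)); rewrite !inE eqxx ?orbT.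
    by split; [apply: dc | split=> //; apply: D_right (dh j)].
  + have /= := @D_foldr t (hd t j) (up (TCell j (a j).1)) [:: now s; now (THead j)] ht (hh j).
    rewrite !addn0 !addn1; apply; last by split; [apply: dst | split].
    by apply: (@in_move _ _ _ _ j _ E); rewrite inE eqxx.
Qed.

Theorem fact_cfg_correct (L : lang Sigma) : L word ->
  (exists w, cfg_lang G w /\ L w) <-> acc (qs n).
Proof.
move=> Lword; split=> [[w [Gw _]]|an].
  apply/acceptsE; apply: (@fact_sound _ _ m TStart init_schemas
    (fun p => row_schemas (cl 0 ^~ p)) machine_schemas fact w) Gw.
  - exact: init_valid.
  - by move=> p r; apply: row_valid.
  - exact: machine_valid.
exists word; split=> //.
have p0 : 0 < 2 ^ m by rewrite expn_gt0.
have dn : derived n.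
  suff h t : t <= n -> derived t by apply: h.
  elim: t => [_|t IH tn]; first exact: derived0.
  by apply: derivedS => //; apply: IH; apply: ltnW.
have da : D TAcc n 0.
  have /= := @D_foldr n 0 (now TAcc) [:: now (TStep (qs n) (sc n))] nm p0.
  rewrite !addn0; apply; last by split=> //; apply: D_step.
  by apply: (@in_step (qs n, sc n)); rewrite inE /= halt an !inE eqxx ?orbT.
(* The start rule asks for acceptance at time 0, so [TAcc] is carried back from time [n], one step
   at a time. *)
have d0 : D TAcc 0 0.
  suff h k : k <= n -> D TAcc (n - k) 0 by have := h n (leqnn n); rewrite subnn.
  elim: k => [_|k IH hk]; first by rewrite subn0.
  have hk' : n - k.+1 < 2 ^ m by lia.
  have /= := @D_foldr (n - k.+1) 0 (now TAcc) [:: up TAcc] hk' p0.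
  rewrite !addn0 !addn1; apply; first by apply: in_global; rewrite mem_head.
  by split=> //; rewrite -subSn // subSS; apply: IH; apply: ltnW.
rewrite /cfg_lang; apply: (@derives_rule _ _ _ _
  (inl (fact_name m TAcc 0 0) :: map inr word)).
  have -> : [seq inr a | a <- word] =
      map (@inst_symbol T Sigma m 0 0) [seq inr a | a <- word] by rewrite -map_comp.
  by apply: (@mem_init T Sigma m TStart init_schemas _ _
    (now TStart, inl (now TAcc) :: map inr word)); rewrite mem_head.
rewrite -cat1s -[map inr word]cat0s [X in derives _ (_ ++ X)]cat0s.
by apply: derives_cat => //; apply: derives_refl.
Qed.

End Computation.

(** * A logarithmic-space transducer *)

(** One pass from the lowest digit with a running carry. With [h] the addition of bits it
    increments; with [h] the first projection it keeps the register while the carry still controls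
    the output. *)
Fixpoint ripple (h : bool -> bool -> bool) (l : seq bool) (c : bool) : seq bool :=
  if l is b :: l' then h b c :: ripple h l' (b && c) else [::].

Lemma size_ripple h l c : size (ripple h l c) = size l.
Proof. by elim: l c => //= b l IH c; rewrite IH. Qed.

Lemma ripple_id l c : ripple (fun b _ => b) l c = l.
Proof. by elim: l c => //= b l IH c; rewrite IH. Qed.

Lemma half_add_bit a (c : bool) : (a + c)./2 = a./2 + (odd a && c).
Proof. by case: c; rewrite ?andbF ?andbT ?addn0 // addn1 -uphalfE uphalf_half addnC. Qed.

Lemma ripple_bin m a c : ripple addb (bin m a) c = bin m (a + c).
Proof.
elim: m a c => //= m IH a c; rewrite oddD half_add_bit -IH.
by case: c.
Qed.

Lemma all_bin m a : a < 2 ^ m -> all id (bin m a) = (a.+1 == 2 ^ m).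
Proof.
elim: m a => [|m IH] a; first by case: a.
rewrite expnS /= => ha; rewrite IH; last by lia.
by rewrite -{3}(odd_double_half a); case: (odd a) => /=; lia.
Qed.

(** The carry leaving an [m]-digit register is the digit of weight [2 ^ m]. This allows [m.+1]
    digits to be printed from an [m]-digit register. *)
Lemma bin_rcons m a c : a < 2 ^ m ->
  rcons (ripple addb (bin m a) c) (c && all id (bin m a)) = bin m.+1 (a + c).
Proof.
elim: m a c => [|m IH] a c.
  by case: a => // _; case: c.
rewrite expnS => ha; have ha2 : a./2 < 2 ^ m by lia.
rewrite [bin m.+1 a]/= [ripple _ _ _]/= rcons_cons.
have -> : c && all id (odd a :: bin m a./2) = (odd a && c) && all id (bin m a./2).
  by rewrite /=; case: c; case: (odd a).
rewrite IH // -half_add_bit -[RHS]/(odd (a + c) :: bin m.+1 (a + c)./2) oddD.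
by case: c {IH}.
Qed.

(** An overflowed counter shows 0 again, so a loop through all values leaves its register ready for
    the next loop. *)
Lemma bin_exp m : bin m (2 ^ m) = bin m 0.
Proof.
elim: m => //= m IH; rewrite expnS mul2n odd_double doubleK IH.
by case: m {IH}.
Qed.

Lemma bin0 m : bin m 0 = nseq m false.
Proof. by elim: m => //= m ->. Qed.

(** * Programs on binary registers, from single passes to the whole reduction *)

Section Transducer.

Variables (A Sigma : finType).
Notation B := (gsym Sigma).
Notation obs := (obs A bool bool).
Notation action := (act B bool bool).
Notation frag := (frag A B bool bool).

Fixpoint ripple_out (f : bool -> bool -> option B) (l : seq bool) (c : bool) : seq B :=
  if l is b :: l' then
    (if f b c is Some y then [:: y] else [::]) ++ ripple_out f l' (b && c)
  else [::].

(** Stack 0 is the time counter, stack 1 the position counter, and stack 3 the length of the input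
    in binary. *)
Definition reg_ops r (o o2 : sop bool) : seq (sop bool) :=
  mkseq (fun j => if j == r then o else if j == 2 then o2 else Keep) 4.

(* Stack 2 is the scratch stack to which a register is moved while it is
   processed from its lowest digit on; the variable holds the carry. *)
Definition forwardA r (h : bool -> bool -> bool) (o : bool -> bool -> option B) :
    obs action := fun c _ t =>
  let b := odflt false (nth None t r) in
  (b && c, MStay, reg_ops r Pop (Push (h b c)), o b c).

Definition backA r : obs action := fun c _ t =>
  (c, MStay, reg_ops r (Push (odflt false (nth None t 2))) Pop, None).

Definition setA (b : bool) : obs action := fun _ _ _ => (b, MStay, [::], None).

Definition outA (b : B) : obs action := fun c _ _ => (c, MStay, [::], Some b).

Definition carryA : obs action := fun c _ _ => (c, MStay, [::], Some (GBit c)).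

(** A remaining carry becomes a new top digit. It is pushed on the scratch stack, whose top is the
    highest digit, and so ends up at the bottom of the register. *)
Definition growA : obs action := fun c _ _ =>
  (c, MStay, [:: Keep; Keep; if c then Push true else Keep], None).

Definition forwardF r h o : frag := whileF (nonempty r) (doF (forwardA r h o)).

Definition backF r : frag := whileF (nonempty 2) (doF (backA r)).

Definition incF r : frag :=
  seqsF [:: doF (setA true); forwardF r addb (fun _ _ => None); backF r].

(** Prints the register plus [d] without changing it: the carry starts as [d], the digits printed
    are those of the sum, and [carryA] adds the top digit. *)
Definition emit_regF r (d : bool) : frag :=
  seqsF [:: doF (setA d);
    forwardF r (fun b _ => b) (fun b c => Some (GBit (b (+) c)));
    doF carryA; backF r].

Definition growF : frag :=
  seqsF [:: doF (setA true); forwardF 3 addb (fun _ _ => None); doF growA; backF 3].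

Section Execution.

Variables (w : seq A) (bound : nat).

Definition fits (ss : seq (seq bool)) : Prop := all (fun s => size s <= bound) ss.

(** The step count is forgotten: logarithmic space asks for termination and for a bound on the
    stacks, which [fits] imposes throughout. *)
Definition reaches (F : frag) s s' := exists t, exec_le 4 w fits F s t s'.

Lemma reaches_do f s s' : fits (sstk s) -> fits (sstk s') -> s' = doact 4 w (look w f s) s ->
  reaches (doF f) s s'.
Proof. by move=> h h' e; exists 1; apply: exec_le_do. Qed.

Lemma reaches_nil s : fits (sstk s) -> reaches (seqsF [::]) s s.
Proof. by exists 0; apply: exec_le_nil. Qed.

Lemma reaches_seqs F Fs s s1 s2 :
  reaches F s s1 -> reaches (seqsF Fs) s1 s2 -> reaches (seqsF (F :: Fs)) s s2.
Proof.
by move=> [t h] [t' h']; exists (t + t').+1; apply: exec_le_seqs h h' _.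
Qed.

Lemma reaches_whileN (b : obs bool) F s : fits (sstk s) -> look w b s = false ->
  reaches (whileF b F) s s.
Proof. by exists 0; apply: exec_le_whileN. Qed.

Lemma reaches_whileT (b : obs bool) F s s1 s2 :
  look w b s -> reaches F s s1 -> reaches (whileF b F) s1 s2 -> reaches (whileF b F) s s2.
Proof.
move=> bs [t h] [t' h']; exists (t + t' + 2).
by apply: exec_le_whileT bs h h' _; lia.
Qed.

Definition reg_store r (c : bool) p t q k x l o : store B bool bool :=
  Store c p (set_nth [::] [:: t; q; x; k] r l) o.

Lemma fits_reg_store r c p t q k x l o : r \in [:: 0; 1; 3] ->
  fits [:: t; q; k] -> size x + size l <= bound ->
  fits (sstk (reg_store r c p t q k x l o)).
Proof.
move=> hr; rewrite /fits /= andbT => /and3P [ht hq hk] hb.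
have hx := leq_trans (leq_addr _ _) hb; have hl := leq_trans (leq_addl _ _) hb.
by move: hr; rewrite !inE => /or3P [] /eqP -> /=; rewrite ?ht ?hq ?hk ?hx ?hl.
Qed.

Section Registers.

Variables (r : nat) (p : nat) (t q k : seq bool).
Hypothesis hr : r \in [:: 0; 1; 3].
Hypothesis pw : p <= (size w).+1.
Hypothesis htqk : fits [:: t; q; k].

Notation S c x l o := (reg_store r c p t q k x l o).

(** The pass moves digits between two stacks and preserves their total height, hence the joint bound
    on [size x + size l]. *)
Lemma forward_exec h f c x l o : size x + size l <= bound ->
  reaches (forwardF r h f) (S c x l o)
    (S (c && all id l) (catrev (ripple h l c) x) [::] (o ++ ripple_out f l c)).
Proof.
elim: l c x o => [|b l IH] c x o hb.
  rewrite andbT cats0; apply: reaches_whileN; first exact: fits_reg_store.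
  by move: hr; rewrite !inE => /or3P [] /eqP ->.
have hb' : size (h b c :: x) + size l <= bound by move: hb => /=; lia.
apply: (@reaches_whileT _ _ _ (S (b && c) (h b c :: x) l
    (if f b c is Some y then rcons o y else o))).
- by move: hr; rewrite !inE => /or3P [] /eqP ->.
- apply: reaches_do; [exact: fits_reg_store | exact: fits_reg_store |].
  by move: hr; rewrite !inE => /or3P [] /eqP ->; rewrite /reg_store /look /=; congr Store; lia.
- have := IH (b && c) (h b c :: x) (if f b c is Some y then rcons o y else o) hb'.
  have -> : c && all id (b :: l) = b && c && all id l by rewrite /= andbA (andbC c).
  rewrite [ripple_out _ (b :: l) _]/=; case: (f b c) => [y|] /=; rewrite ?cat_rcons; exact.
Qed.

Lemma back_exec c x l o : size x + size l <= bound ->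
  reaches (backF r) (S c x l o) (S c [::] (catrev x l) o).
Proof.
elim: x l => [|b x IH] l hb.
  by apply: reaches_whileN; [exact: fits_reg_store | move: hr; rewrite !inE => /or3P [] /eqP ->].
have hb' : size x + size (b :: l) <= bound by move: hb => /=; lia.
apply: (@reaches_whileT _ _ _ (S c x (b :: l) o)); last exact: IH.
- by move: hr; rewrite !inE => /or3P [] /eqP ->.
- apply: reaches_do; [exact: fits_reg_store | exact: fits_reg_store |].
  by move: hr; rewrite !inE => /or3P [] /eqP ->; rewrite /reg_store /look /=; congr Store; lia.
Qed.

Lemma control_exec f (b : bool) (y : option B) c x l o : size x + size l <= bound ->
  (forall a s, f c a s = (b, MStay, [::], y)) ->
  reaches (doF f) (S c x l o) (S b x l (if y is Some y then rcons o y else o)).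
Proof.
move=> hb fE; apply: reaches_do; [exact: fits_reg_store | exact: fits_reg_store |].
rewrite /look fE /=; move: hr; rewrite !inE.
by move=> /or3P [] /eqP ->; rewrite /reg_store /=; congr Store; lia.
Qed.

Lemma inc_exec c m a o : m <= bound -> a < 2 ^ m ->
  reaches (incF r) (S c [::] (bin m a) o) (S (a.+1 == 2 ^ m) [::] (bin m a.+1) o).
Proof.
move=> hm ha.
apply: reaches_seqs; first by apply: (@control_exec _ true None); rewrite ?size_bin.
apply: reaches_seqs; first by apply: forward_exec; rewrite ?size_bin.
rewrite ripple_bin addn1 all_bin //=.
have -> : ripple_out (fun _ _ => None) (bin m a) true = [::].
  by elim: (bin m a) true => //= b l IH c'; rewrite IH.
rewrite cats0; apply: reaches_seqs.
  by apply: back_exec; rewrite catrevE cats0 size_rev size_bin addn0.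
rewrite -[catrev (catrev _ _) _]/(rev (rev _)) revK.
by apply: reaches_nil; apply: fits_reg_store; rewrite ?size_bin.
Qed.

Lemma emit_reg_exec (d : bool) c m a o : m <= bound -> a < 2 ^ m -> exists c',
  reaches (emit_regF r d) (S c [::] (bin m a) o)
    (S c' [::] (bin m a) (o ++ map GBit (bin m.+1 (a + d)))).
Proof.
move=> hm ha; exists (d && all id (bin m a)).
apply: reaches_seqs; first by apply: (@control_exec _ d None); rewrite ?size_bin.
apply: reaches_seqs; first by apply: forward_exec; rewrite ?size_bin.
rewrite ripple_id -bin_rcons // map_rcons -cats1 catA.
have -> : ripple_out (fun b c => Some (GBit (b (+) c))) (bin m a) d =
    map GBit (ripple addb (bin m a) d).
  by elim: (bin m a) d => //= b l IH c'; rewrite IH.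
have szr : size (catrev (bin m a) [::]) + size (@nil bool) <= bound.
  by rewrite catrevE cats0 size_rev size_bin addn0.
apply: reaches_seqs.
  exact: (@control_exec carryA _ (Some (GBit (d && all id (bin m a))))).
rewrite cats1; apply: reaches_seqs; first exact: back_exec.
rewrite -[catrev (catrev _ _) _]/(rev (rev _)) revK.
by apply: reaches_nil; apply: fits_reg_store; rewrite ?size_bin.
Qed.

End Registers.

Definition grow (l : seq bool) : seq bool :=
  if all id l then rcons (ripple addb l true) true else ripple addb l true.

Definition bits (n : nat) : seq bool := iter n grow [::].

(** A digit is added only on overflow, when the value has just become [2 ^ s]; this keeps the length
    logarithmic. *)
Lemma bitsP n : exists s, [/\ bits n = bin s n, n < 2 ^ s & 2 ^ s <= n.*2.+1].
Proof.
elim: n => [|n [s [nE ns sn]]]; first by exists 0.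
rewrite /bits iterS -/(bits n) nE /grow all_bin //; case: eqP => [e|ne].
  exists s.+1; split; [|by rewrite expnS; lia|by rewrite expnS; lia].
  by have := bin_rcons true ns; rewrite all_bin // (introT eqP e) addn1.
by exists s; split; [rewrite ripple_bin addn1|lia|lia].
Qed.

Lemma size_bits n : size (bits n) <= trunc_log 2 n + 1.
Proof.
have [s [-> ns sn]] := bitsP n; rewrite size_bin addn1.
case: s ns sn => // s; rewrite expnS => ns sn; rewrite ltnS.
by apply: trunc_log_max => //; lia.
Qed.

Lemma ltn_bits n : n < 2 ^ size (bits n).
Proof. by have [s [-> ns _]] := bitsP n; rewrite size_bin. Qed.

Lemma grow_exec c p l o : p <= (size w).+1 -> size l < bound -> exists c',
  reaches growF (Store c p [:: [::]; [::]; [::]; l] o)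
    (Store c' p [:: [::]; [::]; [::]; grow l] o).
Proof.
move=> pw hl; exists (all id l).
have f0 : fits [:: [::]; [::]; [::]] by [].
have h3 : 3 \in [:: 0; 1; 3] by [].
have hl' : size (@nil bool) + size l <= bound by exact: ltnW.
apply: reaches_seqs.
  exact: (@control_exec 3 p [::] [::] [::] h3 pw f0 _ true None c [::] l o hl').
apply: reaches_seqs; first exact: (@forward_exec 3 p [::] [::] [::] h3 pw f0 addb _ true [::] l o hl').
have -> : ripple_out (fun _ _ => None) l true = [::].
  by elim: l true {hl hl'} => //= b l IH c'; rewrite IH.
rewrite cats0 [true && _]/=.
pose x := rev (ripple addb l true).
have szx : size x = size l by rewrite size_rev size_ripple.
apply: (@reaches_seqs _ _ _ (reg_store 3 (all id l) p [::] [::] [::]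
    (if all id l then true :: x else x) [::] o)).
  apply: reaches_do.
  - by apply: fits_reg_store; rewrite // -/x szx addn0 ltnW.
  - by apply: fits_reg_store; rewrite //; case: all; rewrite /= szx addn0 // ltnW.
  - rewrite /look /reg_store /= -/x; case: (all id l); congr Store; lia.
apply: reaches_seqs.
  apply: back_exec => //; by case: all; rewrite /= szx addn0 // ltnW.
have -> : catrev (if all id l then true :: x else x) [::] = grow l.
  rewrite /grow /x; case: all; rewrite catrevE cats0 ?rev_cons revK //.
by apply: reaches_nil; rewrite /fits /= andbT /grow; case: all; rewrite ?size_rcons size_ripple // ltnW.
Qed.

End Execution.

(** * Fragments of the transducer: measuring the input, allocating counters, loops and output *)

Definition measureF : frag :=
  seqsF [:: doF (moveA MRight);
    whileF (fun _ a _ => if a is inr _ then true else false)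
      (seqsF [:: growF; doF (moveA MRight)])].

Definition zeroA : obs action := fun c _ _ =>
  (c, MStay, [:: Push false; Push false], None).

Definition digitA : obs action := fun c _ _ =>
  (c, MStay, [:: Keep; Keep; Keep; Pop], None).

(** Allocates two zero counters of [c0] digits plus [c1] digits per binary digit of the input
    length; stack 3 is consumed as the loop counter. *)
Definition setupF (c0 c1 : nat) : frag :=
  seqsF (rcons (nseq c0 (doF zeroA))
    (whileF (nonempty 3) (seqsF (doF digitA :: nseq c1 (doF zeroA))))).

(** The variable doubles as loop test: [incF] leaves the carry out of the register in it, which is
    true exactly when the counter overflows. *)
Definition countF r (body : frag) : frag :=
  seqsF [:: doF (setA false); whileF (fun c _ _ => ~~ c) (seqsF [:: body; incF r])].

(** The text to be printed depends on the scanned letter while a fragment is fixed, hence a case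
    distinction over the finite alphabet with its markers. *)
Definition switchF (f : bool + A -> frag) : frag :=
  foldr (fun a F => ifF (fun _ b _ => b == a) (f a) F) (skipF _ _ _ _)
    (enum {: bool + A}).

Inductive item := Out of B | Reg (r : bool) (d : bool).

Definition itemF (it : item) : frag :=
  match it with
  | Out b => doF (outA b)
  | Reg r d => emit_regF r d
  end.

Definition emitF (its : seq item) : frag := seqsF (map itemF its).

Section Items.

Variable T : finType.

Definition atom_items (x : T * bool * bool) : seq item :=
  Out GNonterm :: map (fun b => Out (GBit b)) (fact_code x.1.1) ++
  [:: Reg false x.1.2; Reg true x.2].

Definition symbol_items (y : T * bool * bool + Sigma) : seq item :=
  match y with inl x => atom_items x | inr a => [:: Out (GTerm a)] end.

Definition rule_items (r : schema T Sigma) : seq item :=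
  Out GRule :: atom_items r.1 ++ flatten (map symbol_items r.2).

Definition blockF (rs : seq (schema T Sigma)) : frag :=
  emitF (flatten (map rule_items rs)).

Definition item_out m i p (it : item) : seq B :=
  match it with
  | Out b => [:: b]
  | Reg r d => map GBit (bin m.+1 ((if r then p else i) + d))
  end.

Definition items_out m i p (its : seq item) : seq B :=
  flatten (map (item_out m i p) its).

Lemma items_out_cat m i p s t :
  items_out m i p (s ++ t) = items_out m i p s ++ items_out m i p t.
Proof. by rewrite /items_out map_cat flatten_cat. Qed.

Lemma items_out_flatten m i p (X : Type) (f : X -> seq item) s :
  items_out m i p (flatten (map f s)) = flatten (map (items_out m i p \o f) s).
Proof. by elim: s => //= x s IH; rewrite items_out_cat IH. Qed.

Lemma items_out_atom m i p x :
  items_out m i p (atom_items x) = encode_nonterm Sigma (inst_atom m i p x).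
Proof.
rewrite /encode_nonterm /inst_atom /fact_name /atom_items.
rewrite /items_out /= map_cat flatten_cat /= cats0 !map_cat -map_comp; congr (_ :: _ ++ _).
  by elim: (fact_code _) => //= b s ->.
by rewrite /= map_cat.
Qed.

Lemma items_out_rule m i p r :
  items_out m i p (rule_items r) = encode_rule (inst m i p r).
Proof.
rewrite -[LHS]/(GRule :: items_out m i p (atom_items r.1 ++ flatten (map symbol_items r.2))).
rewrite items_out_cat items_out_atom items_out_flatten /encode_rule.
congr (_ :: _ ++ flatten _); rewrite /= -map_comp; apply: eq_map => -[x|a] //=.
exact: items_out_atom.
Qed.

Lemma items_out_block m i p rs :
  items_out m i p (flatten (map rule_items rs)) =
  flatten (map (@encode_rule Sigma) (map (inst m i p) rs)).
Proof.
rewrite items_out_flatten -map_comp; congr flatten; apply: eq_map => r.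
exact: items_out_rule.
Qed.

End Items.

Section Output.

Variables (w : seq A) (bound m : nat).
Hypothesis m_bound : m <= bound.

Notation reaches := (reaches w bound).

Definition regs c ps i p o : store B bool bool :=
  Store c ps [:: bin m i; bin m p; [::]; [::]] o.

Lemma fits_regs i p : fits bound [:: bin m i; bin m p; [::]; [::]].
Proof. by rewrite /fits /= !size_bin m_bound. Qed.

Lemma emit_exec its c ps i p o : ps <= (size w).+1 -> i < 2 ^ m -> p < 2 ^ m ->
  exists c', reaches (emitF its) (regs c ps i p o)
    (regs c' ps i p (o ++ items_out m i p its)).
Proof.
move=> pw hi hp; elim: its c o => [|it its IH] c o.
  by exists c; rewrite cats0; apply/reaches_nil/fits_regs.
have [c1 e1] : exists c', reaches (itemF it) (regs c ps i p o)
    (regs c' ps i p (o ++ item_out m i p it)).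
  case: it => [b|[] d] /=.
  - exists c; apply: reaches_do; try exact: fits_regs.
    by rewrite /look /regs /= cats1; congr Store; lia.
  - have f : fits bound [:: bin m i; [::]; [::]] by rewrite /fits /= size_bin m_bound.
    have [c' e] := @emit_reg_exec w bound 1 ps (bin m i) [::] [::] isT pw f d c m p o m_bound hp.
    by exists c'.
  - have f : fits bound [:: [::]; bin m p; [::]] by rewrite /fits /= size_bin m_bound.
    have [c' e] := @emit_reg_exec w bound 0 ps [::] (bin m p) [::] isT pw f d c m i o m_bound hi.
    by exists c'.
have [c2 e2] := IH c1 (o ++ item_out m i p it).
by exists c2; apply: reaches_seqs e1 _; rewrite -catA in e2.
Qed.

(** [S] describes the store as a function of the counter and [ps] the input position, so that the
    loops over times and positions, with or without a moving input head, are all instances. *)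
Lemma count_exec r body (S : bool -> nat -> nat -> seq B -> store B bool bool)
    (ps : nat -> nat) (out : nat -> seq B) o c :
  (forall c ps a o, sv (S c ps a o) = c) ->
  (forall c ps a o, fits bound (sstk (S c ps a o))) ->
  (forall c a o, reaches (doF (setA false)) (S c (ps a) a o) (S false (ps a) a o)) ->
  (forall c a o, a < 2 ^ m ->
     reaches (incF r) (S c (ps a.+1) a o) (S (a.+1 == 2 ^ m) (ps a.+1) a.+1 o)) ->
  (forall c a o, a < 2 ^ m -> exists c',
     reaches body (S c (ps a) a o) (S c' (ps a.+1) a (o ++ out a))) ->
  reaches (countF r body) (S c (ps 0) 0 o)
    (S true (ps (2 ^ m)) (2 ^ m) (o ++ flatten (map out (iota 0 (2 ^ m))))).
Proof.
move=> hS hf hset hinc hbody; apply: reaches_seqs; first exact: hset.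
apply: (reaches_seqs _ (reaches_nil _ (hf _ _ _ _))).
suff loop k a o' : a + k.+1 = 2 ^ m ->
    reaches (whileF (fun c _ _ => ~~ c) (seqsF [:: body; incF r])) (S false (ps a) a o')
    (S true (ps (2 ^ m)) (2 ^ m) (o' ++ flatten (map out (iota a k.+1)))).
  have p0 : 0 < 2 ^ m by rewrite expn_gt0.
  by have := loop (2 ^ m).-1 0 o; rewrite prednK // add0n; apply.
elim: k a o' => [|k IH] a o' ak; have ha : a < 2 ^ m by lia.
all: have [c1 e1] := hbody false a o' ha.
all: have e2 := hinc c1 a (o' ++ out a) ha.
all: apply: reaches_whileT (reaches_seqs e1 (reaches_seqs e2 (reaches_nil _ (hf _ _ _ _)))) _.
all: try by rewrite /look hS.
- have -> : 2 ^ m = a.+1 by rewrite -ak addn1.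
  rewrite eqxx /= cats0; apply: reaches_whileN; [exact: hf | by rewrite /look hS].
- have -> : (a.+1 == 2 ^ m) = false by lia.
  have := IH a.+1 (o' ++ out a); rewrite -catA /=; apply.
  by rewrite addSnnS.
Qed.

End Output.

Lemma switch_exec w bound f s s' : fits bound (sstk s) ->
  reaches w bound (f (input_at w (spos s))) s s' -> reaches w bound (switchF f) s s'.
Proof.
move=> fs e; rewrite /switchF.
have : input_at w (spos s) \in enum {: bool + A} by rewrite mem_enum.
elim: (enum _) => //= a l IH; rewrite inE; case: eqP => [aE _|ne /= /IH [t h]].
  rewrite aE in e; have [t h] := e; exists t.+1.
  by apply: (exec_le_ifT _ h (leqnn _)); rewrite /look aE eqxx.
exists t.+1; apply: (exec_le_ifF _ h (leqnn _)).
by rewrite /look; apply/eqP.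
Qed.

Lemma push_exec w bound j Fs c ps z l o s : ps <= (size w).+1 ->
  z + j <= bound -> size l <= bound ->
  reaches w bound (seqsF Fs)
    (Store c ps [:: nseq (z + j) false; nseq (z + j) false; [::]; l] o) s ->
  reaches w bound (seqsF (nseq j (doF zeroA) ++ Fs))
    (Store c ps [:: nseq z false; nseq z false; [::]; l] o) s.
Proof.
move=> pw; elim: j z => [|j IH] z hz hl e; first by rewrite addn0 in e.
apply: (reaches_seqs (s1 := Store c ps [:: nseq z.+1 false; nseq z.+1 false; [::]; l] o)).
  apply: reaches_do; [| |by rewrite /look /=; congr Store; lia].
  - by rewrite /fits /= !size_nseq hl; lia.
  - by rewrite /fits /= !size_nseq hl; lia.
by apply: IH => //; rewrite addSnnS.
Qed.

Lemma setup_exec w bound c0 c1 c ps l o : ps <= (size w).+1 ->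
  c0 + size l * c1 <= bound -> size l <= bound ->
  reaches w bound (setupF c0 c1) (Store c ps [:: [::]; [::]; [::]; l] o)
    (regs (c0 + size l * c1) c ps 0 0 o).
Proof.
move=> pw hb hl; rewrite /setupF -cats1 -[X in Store _ _ [:: X; X; _; _] _]/(nseq 0 false).
apply: push_exec => //; first by lia.
rewrite add0n /regs bin0.
set n := c0 + size l * c1 in hb *.
have fn : fits bound [:: nseq n false; nseq n false; [::]; [::]].
  by rewrite /fits /= !size_nseq hb.
apply: reaches_seqs; last by apply: reaches_nil.
rewrite {}/n in hb fn *.
elim: l c0 hb hl fn => [|b l IH] c0 hb hl fn.
  by rewrite addn0 in fn *; apply: reaches_whileN.
apply: (reaches_whileT (s1 := Store c ps
    [:: nseq (c0 + c1) false; nseq (c0 + c1) false; [::]; l] o)); first by [].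
- move: hb hl => /=; rewrite mulSn => hb hl.
  apply: (reaches_seqs (s1 := Store c ps [:: nseq c0 false; nseq c0 false; [::]; l] o)).
    apply: reaches_do; [| |by rewrite /look /=; congr Store; lia].
    - by rewrite /fits /= !size_nseq; lia.
    - by rewrite /fits /= !size_nseq; lia.
  rewrite -[nseq c1 _]cats0; apply: push_exec => //; [by lia|by lia|].
  by apply: reaches_nil; rewrite /fits /= !size_nseq; lia.
- move: hb fn => /=; rewrite mulSn addnA => hb fn.
  by apply: IH => //; apply: ltnW.
Qed.

Lemma measure_exec w bound : trunc_log 2 (size w) + 1 < bound -> exists c,
  reaches w bound measureF (Store false 0 (nseq 4 [::]) [::])
    (Store c (size w).+1 [:: [::]; [::]; [::]; bits (size w)] [::]).
Proof.
move=> hb.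
have szb j : j <= size w -> size (bits j) < bound.
  move=> hj; apply: leq_ltn_trans (size_bits _) (leq_ltn_trans _ hb).
  by rewrite leq_add2r leq_trunc_log.
have fj j : j <= size w -> fits bound [:: [::]; [::]; [::]; bits j].
  by move=> /szb hj; rewrite /fits /= andbT ltnW.
suff loop u v c : w = u ++ v -> exists c',
    reaches w bound (whileF (fun _ a _ => if a is inr _ then true else false)
      (seqsF [:: growF; doF (moveA MRight)]))
    (Store c (size u).+1 [:: [::]; [::]; [::]; bits (size u)] [::])
    (Store c' (size w).+1 [:: [::]; [::]; [::]; bits (size w)] [::]).
  have [c e] := loop [::] w false erefl; exists c.
  apply: (reaches_seqs (s1 := Store false 1 [:: [::]; [::]; [::]; bits 0] [::])).
    apply: reaches_do; [exact: (fj 0)|exact: (fj 0)|].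
    by rewrite /look /=; congr Store; lia.
  by apply: (reaches_seqs e); apply: reaches_nil; apply: fj.
elim: v u c => [|a v IH] u c wE.
  have szu : size w = size u by rewrite wE cats0.
  rewrite szu; exists c; apply: reaches_whileN; first by apply: fj; rewrite szu.
  by rewrite /look /= wE input_at_cat.
have sz : size w = (size u + size v).+1 by rewrite wE size_cat /= addnS.
have [|c1 e1] := IH (rcons u a) c; first by rewrite cat_rcons.
have hu : size u <= size w by lia.
have hp : (size u).+1 <= (size w).+1 by lia.
have [c2 e2] := grow_exec c [::] hp (szb _ hu).
have [|c3 e3] := IH (rcons u a) c2; first by rewrite cat_rcons.
exists c3; apply: reaches_whileT e3.
  by rewrite /look /= wE input_at_cat.
apply: (reaches_seqs e2); rewrite size_rcons; have hu' : (size u).+1 <= size w by lia.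
apply: reaches_seqs; last by apply: reaches_nil; apply: fj.
apply: reaches_do; [exact: fj hu' | exact: fj hu' |].
by rewrite /look /=; congr Store; lia.
Qed.

Definition transducerF (T : finType) c0 c1 (start : T) (init : seq (schema T Sigma))
    (row : bool + A -> seq (schema T Sigma)) (rules : seq (schema T Sigma)) : frag :=
  seqsF [:: measureF; setupF c0 c1; rewindF;
    emitF (atom_items (start, false, false)); blockF init;
    countF 1 (seqsF [:: switchF (fun a => blockF (row a)); doF (moveA MRight)]);
    countF 0 (countF 1 (blockF rules))].

Section Reduction.

Variables (T : finType) (c0 c1 : nat) (start : T) (init : seq (schema T Sigma)).
Variables (row : bool + A -> seq (schema T Sigma)) (rules : seq (schema T Sigma)).

(** As [n < 2 ^ size (bits n)], the range [2 ^ width n] is at least [2 ^ c0 * n ^ c1], while the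
    width itself is logarithmic. *)
Definition width (n : nat) : nat := c0 + size (bits n) * c1.

Definition reduction (w : seq A) : seq B :=
  encode_cfg (fact_cfg (width (size w)) start init
    (fun p => row (input_at w p)) rules).

Let flatten_encode (X : Type) (f : X -> seq (seq bool * seq (seq bool + Sigma))) s :
  flatten (map (@encode_rule Sigma) (flatten (map f s))) =
  flatten (map (fun x => flatten (map (@encode_rule Sigma) (f x))) s).
Proof. by elim: s => //= x s IH; rewrite map_cat flatten_cat IH. Qed.

Lemma transducer_exec w bound :
  width (size w) + trunc_log 2 (size w) + 1 < bound -> exists s,
  reaches w bound (transducerF c0 c1 start init row rules)
    (Store false 0 (nseq 4 [::]) [::]) s /\ sout s = reduction w.
Proof.
set m := width _ => hb; have mb : m <= bound by lia.
have p0 : 0 < 2 ^ m by rewrite expn_gt0.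
have [|c e1] := @measure_exec w bound; first by lia.
have pw : (size w).+1 <= (size w).+1 by [].
have bb : size (bits (size w)) <= bound.
  by apply: leq_trans (size_bits _) _; lia.
have e2 := setup_exec (c0 := c0) (c1 := c1) c [::] pw mb bb.
rewrite -/(width _) -/m in e2.
have e3 : reaches w bound rewindF (regs m c (size w).+1 0 0 [::]) (regs m c 0 0 0 [::]).
  by exists (3 * (size w).+1); apply: rewind_exec => //; apply: fits_regs.
have [c4 e4] := @emit_exec w bound m mb (atom_items (start, false, false)) c 0 0 0 [::] (leq0n _) p0 p0.
rewrite items_out_atom /= in e4; set o4 := encode_nonterm _ _ in e4.
have o4E : o4 = encode_nonterm Sigma (fact_name m start 0 0) by [].
clearbody o4.
have [c5 e5] := @emit_exec w bound m mb (flatten (map (@rule_items T) init)) c4 0 0 0 o4 (leq0n _) p0 p0.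
rewrite items_out_block in e5; set o5 := o4 ++ _ in e5.
(* The input head stops at the right marker while the counter runs on. [input_at] yields the right
   marker at all later positions too, so the printed rows are the required ones. *)
pose ps p := minn p (size w).+1.
pose out6 p := flatten (map (@encode_rule Sigma)
  (map (inst m 0 p) (row (input_at w p)))).
have hps p : ps p <= (size w).+1 by rewrite /ps; lia.
have set_exec (b c' : bool) q i p o : q <= (size w).+1 ->
    reaches w bound (doF (setA b)) (regs m c' q i p o) (regs m b q i p o).
  by move=> hq; apply: reaches_do; [exact: fits_regs|exact: fits_regs|];
    rewrite /look /regs /=; congr Store; lia.
have inc1 c' q i p o : q <= (size w).+1 -> p < 2 ^ m ->
    reaches w bound (incF 1) (regs m c' q i p o) (regs m (p.+1 == 2 ^ m) q i p.+1 o).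
  move=> hq hp; have f : fits bound [:: bin m i; [::]; [::]].
    by rewrite /fits /= size_bin mb.
  exact: (@inc_exec w bound 1 q (bin m i) [::] [::] isT hq f).
have inc0 c' q i p o : q <= (size w).+1 -> i < 2 ^ m ->
    reaches w bound (incF 0) (regs m c' q i p o) (regs m (i.+1 == 2 ^ m) q i.+1 p o).
  move=> hq hp; have f : fits bound [:: [::]; bin m p; [::]].
    by rewrite /fits /= size_bin mb.
  exact: (@inc_exec w bound 0 q [::] (bin m p) [::] isT hq f).
have e6 := @count_exec w bound m mb 1
  (seqsF [:: switchF (fun a => blockF (row a)); doF (moveA MRight)])
  (fun c q p o => regs m c q 0 p o) ps out6 o5 c5.
have {}e6 : reaches w bound (countF 1 (seqsF [:: switchF (fun a => blockF (row a));
    doF (moveA MRight)])) (regs m c5 0 0 0 o5)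
    (regs m true (ps (2 ^ m)) 0 (2 ^ m) (o5 ++ flatten (map out6 (iota 0 (2 ^ m))))).
  apply: e6 => //.
  - by move=> *; apply: fits_regs.
  - by move=> *; apply: set_exec.
  - by move=> *; apply: inc1.
  - move=> c' p o hp.
    have [c2 e] := emit_exec mb (flatten (map (@rule_items T) (row (input_at w p)))) c' o (hps p) p0 hp.
    rewrite items_out_block in e; exists c2.
    apply: (@reaches_seqs _ _ _ _ _ (regs m c2 (ps p) 0 p (o ++ out6 p))).
      apply: switch_exec; first exact: fits_regs.
      have -> // : input_at w (spos (regs m c' (ps p) 0 p o)) = input_at w p.
      rewrite /= /ps; case: (leqP p (size w).+1) => // le.
      case: p le {hp e} => // p le.
      by rewrite /input_at !onth_default //; lia.
    apply: reaches_seqs; last by apply: reaches_nil; apply: fits_regs.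
    apply: reaches_do; [exact: fits_regs|exact: fits_regs|].
    by rewrite /look /regs /=; congr Store; rewrite /ps; lia.
set o6 := o5 ++ _ in e6; set q := ps (2 ^ m) in e6.
(* The position counter has overflowed to zero, as the following loops expect. *)
have {}e6 : reaches w bound (countF 1 (seqsF [:: switchF (fun a => blockF (row a));
    doF (moveA MRight)])) (regs m c5 0 0 0 o5) (regs m true q 0 0 o6).
  by move: e6; rewrite /regs bin_exp.
have hq : q <= (size w).+1 by apply: hps.
pose out7 i p := flatten (map (@encode_rule Sigma) (map (inst m i p) rules)).
have inner c' i o : i < 2 ^ m ->
    reaches w bound (countF 1 (blockF rules)) (regs m c' q i 0 o)
      (regs m true q i 0 (o ++ flatten (map (out7 i) (iota 0 (2 ^ m))))).
  move=> hi; have := @count_exec w bound m mb 1 (blockF rules)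
    (fun c q p o => regs m c q i p o) (fun=> q) (out7 i) o c'.
  rewrite /= /regs bin_exp; apply=> //.
  - by move=> *; apply: fits_regs.
  - by move=> *; apply: set_exec.
  - by move=> *; apply: inc1.
  - move=> c2 p o2 hp.
    have [c3 e] := emit_exec mb (flatten (map (@rule_items T) rules)) c2 o2 hq hi hp.
    by rewrite items_out_block in e; exists c3.
have e7 := @count_exec w bound m mb 0 (countF 1 (blockF rules))
    (fun c q i o => regs m c q i 0 o) (fun=> q)
    (fun i => flatten (map (out7 i) (iota 0 (2 ^ m)))) o6 true.
have {}e7 := e7 (fun _ _ _ _ => erefl) (fun _ _ _ _ => fits_regs mb _ _).
have {}e7 := e7 (fun _ _ _ => set_exec _ _ _ _ _ _ hq).
have {}e7 := e7 (fun _ _ _ h => inc0 _ _ _ _ _ hq h).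
have {}e7 := e7 (fun _ _ _ h => ex_intro _ true (inner _ _ _ h)).
eexists; split.
  apply: (reaches_seqs e1); apply: (reaches_seqs e2); apply: (reaches_seqs e3).
  apply: (reaches_seqs e4); apply: (reaches_seqs e5); apply: (reaches_seqs e6).
  by apply: (reaches_seqs e7); apply: reaches_nil; apply: fits_regs.
rewrite [sout _]/= /o6 /o5 /reduction -/m /encode_cfg [cfg_rules _]/= !map_cat.
rewrite !flatten_cat !flatten_encode -!catA.
rewrite -[encode_nonterm _ _]/(encode_nonterm Sigma (fact_name m start 0 0)) -o4E.
congr (_ ++ (_ ++ (_ ++ flatten _))); apply: eq_map => i.
by rewrite flatten_encode.
Qed.

Theorem reduction_logspace : logspace_computable reduction.
Proof.
(* Stacks stay within [c0 + size (bits n) * c1 + trunc_log 2 n + 2] for [n = size w]. Since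
   [size (bits n) <= trunc_log 2 n + 1], the constant [c0 + c1 + 5] leaves a strict inequality. *)
exists (compile 4 (transducerF c0 c1 start init row rules) false xpred0), (c0 + c1 + 5) => w.
pose bound := width (size w) + trunc_log 2 (size w) + 2.
have [|s [[t [n _ e]] os]] := @transducer_exec w bound; first by rewrite /bound; lia.
have [[c [hc oc _]] heads] := compile_exec xpred0 e.
split; first by exists (2 * n), c; split=> //; rewrite oc.
move=> i d /heads [ss fs hd] j; rewrite hd.
apply: (@leq_ltn_trans bound).
  have [hj|hj] := ltnP j (size ss); last by rewrite nth_default.
  by move/all_nthP: fs; apply.
rewrite /bound /width; have := size_bits (size w).
move: (size _) (trunc_log _ _) => b l hbl; nia.
Qed.

End Reduction.

End Transducer.

(** * Hardness *)

Section Hardness.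

Variables (A Sigma : finType) (M : tm A void) (word : seq Sigma).

(* The input tape is the tape [None], the work tape [j] the tape [Some j]. *)
Let J : finType := option 'I_(tm_tapes M).
Let U : finType := ((bool + A) + option (tm_sym M))%type.
Let Q := tm_state M.
Notation F := {ffun J -> U}.

Definition input_cell (u : U) : bool + A := if u is inl a then a else inl false.

Definition work_cell (u : U) : option (tm_sym M) := if u is inr s then s else None.

(** The tapes of the clauses have no right end, whereas the input head is held back at the right
    marker; a right move there becomes a stay. *)
Definition input_move (a : bool + A) (m : move) : move :=
  match a, m with inl true, MRight => MStay | _, _ => m end.

Definition multi_delta (q : Q) (f : F) : option (Q * {ffun J -> U * move}) :=
  let a := input_cell (f None) in
  if tm_trans q a [ffun i => work_cell (f (Some i))] is Some (q', m, act, _) then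
    Some (q', [ffun j : J => if j is Some i then (inr (act i).1, (act i).2)
                             else (inl a, input_move a m)])
  else None.

Definition start_cell (a : bool + A) (j : J) : U :=
  if j is Some _ then inr None else inl a.

Section Trajectory.

Variable w : seq A.

(** A total trajectory that repeats the halting configuration, as the semantics of the clauses
    assumes. *)
Definition conf t : config M := iter t (fun c => odflt c (next w c)) (init M).

Definition heads t (j : J) : nat :=
  if j is Some i then c_head (conf t) i else c_input (conf t).

Definition cells t (j : J) p : U :=
  if j is Some i then inr (c_tape (conf t) i p) else inl (input_at w p).

Lemma input_pos t : c_input (conf t) <= (size w).+1.
Proof.
elim: t => //= t IH; rewrite {1}/next.
by case: (tm_trans _ _ _) => [[[[q m] act] o]|] //=; lia.
Qed.

Let scan t : F := [ffun j => cells t j (heads t j)].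

Lemma multi_deltaE t : multi_delta (c_state (conf t)) (scan t) =
  let a := input_at w (c_input (conf t)) in
  if tm_trans (c_state (conf t)) a
    [ffun i => c_tape (conf t) i (c_head (conf t) i)] is Some (q', m, act, _) then
    Some (q', [ffun j : J => if j is Some i then (inr (act i).1, (act i).2)
                             else (inl a, input_move a m)])
  else None.
Proof.
rewrite /multi_delta ffunE /=; have -> // : [ffun i => work_cell (scan t (Some i))] =
  [ffun i => c_tape (conf t) i (c_head (conf t) i)].
by apply/ffunP => i; rewrite !ffunE.
Qed.

Lemma multi_step_some t q a : multi_delta (c_state (conf t)) (scan t) = Some (q, a) ->
  [/\ c_state (conf t.+1) = q, forall j, heads t.+1 j = shift (a j).2 (heads t j) &
    forall j p, cells t.+1 j p = if p == heads t j then (a j).1 else cells t j p].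
Proof.
rewrite multi_deltaE /= /heads /cells /= -/(conf t) /next.
case: (tm_trans _ _ _) => [[[[q' m] act] o]|] //= [<- <-]; split=> // [[i|]|[i|] p] /=.
- by rewrite ffunE.
(* A head that reads the right marker stands exactly at [(size w).+1], by [input_pos], so truncating
   the move agrees with [input_move]. *)
- rewrite ffunE /=; have := input_pos t; rewrite /input_at.
  case: (c_input (conf t)) => [|p] /=; first by case: m => /=; lia.
  case E: (onth w p) => [b|]; first last.
    by move=> hp; have := onthNE w p; rewrite E /= => /esym hw; case: m => /=; lia.
  by have := onthTE w p; rewrite E /= => /esym hw _; case: m => /=; lia.
- by rewrite ffunE /=; case: eqP.
- by rewrite ffunE /=; case: eqP => [->|].
Qed.

Lemma multi_step_none t : multi_delta (c_state (conf t)) (scan t) = None ->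
  [/\ c_state (conf t.+1) = c_state (conf t), forall j, heads t.+1 j = heads t j &
    forall j p, cells t.+1 j p = cells t j p].
Proof.
rewrite multi_deltaE /= /heads /cells /= -/(conf t) /next.
by case: (tm_trans _ _ _) => [[[[q' m] act] o]|] //=.
Qed.

Lemma multi_delta_halt t :
  multi_delta (c_state (conf t)) (scan t) = None <-> next w (conf t) = None.
Proof.
rewrite multi_deltaE /next /=.
by case: (tm_trans _ _ _) => [[[[q' m] act] o]|].
Qed.

Lemma run_conf n (c : config M) t : halts_with w n c -> t <= n -> run M w t = Some (conf t).
Proof.
move=> [rn _]; elim: t => // t IH tn; have rt := IH (ltnW tn).
rewrite (runS rt) /conf iterS -/(conf t); case E: (next w (conf t)) => [c'|] //.
move: rn; rewrite -(subnK tn) /run iterD -/(run _ _ t.+1) (runS rt) E.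
have -> // : forall k, iter k (obind (next (M := M) w)) None = None.
by elim=> //= k ->.
Qed.

Lemma reduction_correct (L : lang Sigma) m n (c : config M) : L word ->
  halts_with w n c -> n < 2 ^ m ->
  (exists u, cfg_lang (fact_cfg m TStart (init_schemas J U Q word)
     (fun p => row_schemas Sigma (tm_start M) (start_cell (input_at w p)))
     (machine_schemas Sigma multi_delta (@tm_accept _ _ M))) u /\ L u) <->
  tm_accept (c_state c).
Proof.
move=> Lw hc nm; have cE : c = conf n.
  by have := run_conf hc (leqnn n); case: hc => -> _ [].
have halt : multi_delta (c_state (conf n)) (scan n) = None.
  by apply/multi_delta_halt; rewrite -cE; case: hc.
have nhalt t : t < n -> multi_delta (c_state (conf t)) (scan t) <> None.
  move=> tn /multi_delta_halt E; have := run_conf hc tn.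
  by rewrite (runS (run_conf hc (ltnW tn))) E.
rewrite cE.
have h0 j : heads 0 j = 0 by case: j.
exact: (@fact_cfg_correct J U Q Sigma m (tm_start M) multi_delta (@tm_accept _ _ M)
  word (fun t => c_state (conf t)) heads cells erefl h0 multi_step_some
  multi_step_none n nm halt nhalt L Lw).
Qed.

End Trajectory.
End Hardness.

Theorem cfg_ip_P_hard (Sigma : finType) (L : lang Sigma) :
  (exists u, L u) -> P_hard (cfg_ip L).
Proof.
move=> [u Lu] A X [M [k [d hM]]].
exists (@reduction A Sigma _ (2 * k) d TStart (init_schemas _ _ _ u)
  (fun a => row_schemas Sigma (tm_start M) (@start_cell A M a))
  (machine_schemas Sigma (@multi_delta A M) (@tm_accept _ _ M))).
split=> [|w]; first exact: reduction_logspace.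
have [n [c [hn hc ->]]] := hM w.
(* With [b = (2 ^ size (bits (size w))) ^ d], which is positive and at least [size w ^ d], the time
   is at most [2 * k * b], below [2 ^ (2 * k) * b]. This fixes the parameters [2 * k] and [d]. *)
have nm : n < 2 ^ width (2 * k) d (size w).
  apply: leq_ltn_trans hn _; rewrite /width expnD (expnM _ (size _)).
  have h1 : 2 * k < 2 ^ (2 * k) by apply: ltn_expl.
  have h2 : size w ^ d <= (2 ^ size (bits (size w))) ^ d.
    by case: (posnP d) => [->|d0] //; rewrite leq_exp2r // ltnW // ltn_bits.
  have h3 : 0 < (2 ^ size (bits (size w))) ^ d by rewrite !expn_gt0.
  move: (2 ^ (2 * k)) ((2 ^ _) ^ d) (size w ^ d) h1 h2 h3 => a b e h1 h2 h3.
  by apply: (@leq_ltn_trans (2 * k * b)); [nia | rewrite ltn_pmul2r].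
(* Injectivity of the encoding identifies the grammar provided by [cfg_ip] with the constructed
   one. *)
rewrite -(reduction_correct Lu hc nm); split=> [[v [Gv Lv]]|[G [/encode_cfg_inj <- hv]]].
  by eexists; split; [reflexivity | exists v].
exact: hv.
Qed.

Theorem theorem6p1 (Sigma : finType) (L : lang Sigma) :
  regular L -> (exists w, L w) -> P_complete (cfg_ip L).
Proof.
move=> [M LM] Lne; split; first exact: cfg_ip_in_P LM.
exact: cfg_ip_P_hard.
Qed.
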